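(* Let $\mathcal I$ be a free ideal on $\mathbb N_0$ and let $\mathbf u=(u_n)_{n\in\mathbb N_0}$ be a $TB^{\mathcal I}$-sequence in an abelian group $G$. Then $$T^{\mathcal I}_{\mathbf{pu}} = (T^{\mathcal I}_{\mathbf u})^+=\sigma(G,s^{\mathcal I}_{\mathbf u}(G^\wedge)),$$ and $s^{\mathcal I}_{\mathbf u}(G^\wedge)=(G,T^{\mathcal I}_{\mathbf u})^\wedge=(G,T^{\mathcal I}_{\mathbf{pu}})^\wedge$.
   Context: $\mathbb N_0=\{0,1,2,\dots\}$, $\mathbb T=\mathbb R/\mathbb Z$. An ideal $\mathcal I$ on $\mathbb N_0$ is a nonempty family of subsets of $\mathbb N_0$ closed under taking subsets and finite unions; it is free if it contains all finite subsets of $\mathbb N_0$. A sequence $(x_n)$ in a topological space $\mathcal I$-converges to $x$ if $\{n\in\mathbb N_0: x_n\notin U\}\in\mathcal I$ for every neighborhood $U$ of $x$. ''Precompact'' means Hausdorff and totally bounded. A sequence $\mathbf u$ in an abelian group $G$ is a $T^{\mathcal I}$-sequence (resp., $TB^{\mathcal I}$-sequence) if there is a Hausdorff (resp., precompact) group topology on $G$ in which $\mathbf u$ $\mathcal I$-converges to $0$; every $TB^{\mathcal I}$-sequence is a $T^{\mathcal I}$-sequence. $T^{\mathcal I}_{\mathbf u}$ (resp., $T^{\mathcal I}_{\mathbf{pu}}$) denotes the finest Hausdorff (resp., finest precompact) group topology on $G$ in which $\mathbf u$ $\mathcal I$-converges to $0$ (the supremum of all Hausdorff, resp. precompact, group topologies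 with this property). For a topological abelian group $(G,\tau)$, $(G,\tau)^\wedge$ is the group of continuous homomorphisms $(G,\tau)\to\mathbb T$. For a subgroup $H\le\mathrm{Hom}(G,\mathbb T)$, $\sigma(G,H)$ is the coarsest group topology on $G$ making all $\chi\in H$ continuous, and $\tau^+:=\sigma(G,(G,\tau)^\wedge)$. Here $G^\wedge=\mathrm{Hom}(G,\mathbb T)$ (dual of the discrete group $G$) and $s^{\mathcal I}_{\mathbf u}(G^\wedge)=\{\chi\in\mathrm{Hom}(G,\mathbb T): \chi(u_n)\ \mathcal I\text{-converges to }0\text{ in }\mathbb T\}$. *)

(* Defs.v *)
From HB Require Import structures.
From mathcomp Require Import all_boot all_order all_algebra.
From mathcomp Require Import all_classical all_reals topology normedtype.

Set Implicit Arguments.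
Unset Strict Implicit.
Unset Printing Implicit Defensive.

Import GRing.Theory Num.Theory.
Import numFieldNormedType.Exports.

Local Open Scope classical_set_scope.
Local Open Scope ring_scope.

Definition int_subgroup (R : realType) : zmodClosed R :=
  GRing.ZmodClosed.clone R (@Num.int_num_subdef R) _.

Definition circle (R : realType) : Type :=
  quotient_topology (Quotient.quot (int_subgroup R)).

HB.instance Definition _ (R : realType) :=
  Topological.copy (circle R)
    (quotient_topology (Quotient.quot (int_subgroup R))).

(** The group structure of [Quotient.quot] cannot be copied: its choice operator
    differs from that of [quotient_topology]. *)
HB.instance Definition _ (R : realType) :=
  GRing.isZmodule.Build (circle R)
    (@Quotient.addqA R (int_subgroup R)) (@Quotient.addqC R (int_subgroup R))
    (@Quotient.add0q R (int_subgroup R)) (@Quotient.addNq R (int_subgroup R)).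

Lemma circle_sub_continuous (R : realType) :
  continuous (fun p : circle R * circle R => p.1 - p.2).
Proof.
pose pi (x : R) : circle R := (\pi_(Quotient.quot (int_subgroup R)) x)%qT.
have piB x y : pi (x - y) = pi x - pi y by exact: raddfB.
have piP (q : circle R) : exists x, pi x = q.
  by exists (repr (q : Quotient.quot (int_subgroup R))); rewrite /pi reprK.
have pi_open (V : set R) : open V -> open (pi @` V).
  move=> oV; rewrite /open /= /quotient_open openE => y -[v Vv].
  rewrite -[(\pi_ _ y)%qT]/(pi y) => piv.
  have : \forall z \near y, V (z + (v - y)).
    have : (z + (v - y)) @[z --> y] --> y + (v - y).
      apply: cvgD; [exact: cvg_id|exact: cvg_cst].
    by rewrite (addrC y) subrK; apply; exact: open_nbhs_nbhs.
  apply: filterS => z Vz; exists (z + (v - y)) => //.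
  by rewrite -opprB piB piB piv subrr subr0.
have pi_cont : continuous pi by exact: pi_continuous.
move=> [a b]; have [[x <-] [y <-]] := (piP a, piP b).
move=> A; rewrite /= -piB => nA.
have [[V W] /= [nV nW] VW] : nbhs (x, y) ((fun p => pi (p.1 - p.2)) @^-1` A).
  exact: (@sub_continuous R (x, y) _ (pi_cont (x - y) _ nA)).
rewrite nbhsE /= in nV; rewrite nbhsE /= in nW.
case: nV nW => [V' [oV' V'x] V'V] [W' [oW' W'y] W'W].
exists (pi @` V', pi @` W') => /=.
  split; apply: open_nbhs_nbhs; split; [exact: pi_open|by exists x| |].
    exact: pi_open.
  by exists y.
move=> [_ _] /= [[v V'v <-] [w W'w <-]].
by rewrite -piB; apply: (VW (v, w)); split; [exact: V'V|exact: W'W].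
Qed.

HB.instance Definition _ (R : realType) :=
  PreTopologicalNmodule_isTopologicalZmodule.Build (circle R)
    (@circle_sub_continuous R).

(** The improper ideal [setT] is allowed. *)
Definition is_ideal (I : set (set nat)) : Prop :=
  [/\ I !=set0,
      forall A B, A `<=` B -> I B -> I A &
      forall A B, I A -> I B -> I (A `|` B)].

Definition free_ideal (I : set (set nat)) : Prop :=
  forall A, finite_set A -> I A.

Definition ideal_cvg (I : set (set nat)) (X : topologicalType)
    (x : nat -> X) (l : X) : Prop :=
  forall U, nbhs l U -> I [set n | ~ U (x n)].

(** As several topologies on one group [G] are compared, a topology on [G] is a
    term [t : Topological G], and [space t] is [G] endowed with [t]. Two
    topologies are equal when they have the same open sets: equality in
    [Topological G] would also compare irrelevant components, such as the
    choice operator. *)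

Definition space (G : Type) (t : Topological G) : topologicalType :=
  Topological.Pack t.

Definition opens (G : Type) (t : Topological G) : set (set G) :=
  @open (space t).

Section Topologies.
Variable G : zmodType.
Implicit Types (t : Topological G) (P : set (Topological G)).

Definition group_topology t : Prop :=
  continuous (fun p : space t * space t => (p.1 : G) + (p.2 : G) : space t) /\
  continuous (fun x : space t => - (x : G) : space t).

Definition hausdorff_group_topology t : Prop :=
  group_topology t /\ hausdorff_space (space t).

Definition totally_bounded t : Prop :=
  forall U : set G, nbhs ((0 : G) : space t) U ->
    exists2 F : set G, finite_set F & [set x + y | x in F & y in U] = setT.

Definition precompact_group_topology t : Prop :=
  hausdorff_group_topology t /\ totally_bounded t.

Definition sup_of P : Topological G :=
  Topological.class (sup_topology (fun t : {t | P t} => sval t)).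

Variables (I : set (set nat)) (u : nat -> G).

Definition cvg0_in t : Prop := ideal_cvg I (u : nat -> space t) (0 : G).

Definition TB_sequence : Prop :=
  exists t, precompact_group_topology t /\ cvg0_in t.

Definition T_u : Topological G :=
  sup_of [set t | hausdorff_group_topology t /\ cvg0_in t].

Definition T_pu : Topological G :=
  sup_of [set t | precompact_group_topology t /\ cvg0_in t].

End Topologies.

Section Duality.
Variables (R : realType) (G : zmodType).
Implicit Types (t : Topological G) (H : set {additive G -> circle R}).

Definition dual t : set {additive G -> circle R} :=
  [set chi | continuous (chi : space t -> circle R)].

(** Supremum of the initial topologies of the characters in [H]; it is the
    coarsest group topology making them continuous by [sigma_coarsest]. *)
Definition sigma H : Topological G :=
  Topological.class (sup_topology (fun chi : {chi | H chi} =>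
    Topological.class (initial_topology (sval chi : G -> circle R)))).

Definition plus_topology t : Topological G := sigma (dual t).

Definition s_u (I : set (set nat)) (u : nat -> G) :
    set {additive G -> circle R} :=
  [set chi : {additive G -> circle R} | ideal_cvg I (fun n => chi (u n)) 0].

Lemma sigma_coarsest H :
  [/\ group_topology (sigma H),
      forall chi, H chi -> dual (sigma H) chi &
      forall t, group_topology t -> (forall chi, H chi -> dual t chi) ->
        opens (sigma H) `<=` opens t].
Proof.
have cont chi : H chi -> dual (sigma H) chi.
  move=> Hchi; rewrite /dual /= => x.
  have [+ _] := cvg_sup (fun chi : {chi | H chi} =>
      Topological.class (initial_topology (sval chi : G -> circle R)))
    x (nbhs_filter (x : space (sigma H))).
  move=> /(_ (@cvg_id _ _)) /(_ (exist _ chi Hchi)) xx.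
  exact: cvg_comp xx (@initial_continuous _ _ (chi : G -> circle R) x).
have lift (X : topologicalType) (f : X -> space (sigma H)) :
    (forall chi, H chi -> continuous (chi \o f : X -> circle R)) ->
    continuous f.
  move=> fc x; apply/cvg_sup => -[chi Hchi] A /=.
  rewrite (@nbhsE (initial_topology (chi : G -> circle R))).
  move=> [_ [[B oB <-] Bfx] BA]; apply: filterS BA _.
  by apply: (fc chi Hchi x); exact: open_nbhs_nbhs.
split=> //.
- split.
  + apply: lift => chi Hchi [a b].
    have sum := continuous2_cvg _
      (@add_continuous (circle R) (chi a : circle R, chi b : circle R))
      (cvg_comp _ _ (@cvg_fst _ _ (nbhs a) (nbhs b) _) (cont chi Hchi a))
      (cvg_comp _ _ (@cvg_snd _ _ (nbhs a) (nbhs b) _) (cont chi Hchi b)).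
    rewrite /continuous_at [X in X @ _](_ : _ =
      fun p : space (sigma H) * space (sigma H) => chi p.1 + chi p.2).
      by rewrite /= raddfD; exact: sum.
    by apply/funext => p; rewrite /= raddfD.
  + apply: lift => chi Hchi a.
    have opp := cvg_comp _ _ (cont chi Hchi a)
      (@opp_continuous (circle R) (chi a : circle R)).
    rewrite /continuous_at [X in X @ _](_ : _ = fun x : G => - chi x).
      by rewrite /= raddfN; exact: opp.
    by apply/funext => x; rewrite /= raddfN.
- move=> t tg tc.
  have /continuousP idc : continuous (id : space t -> space (sigma H)).
    by apply: lift => chi Hchi; exact: tc.
  by move=> A oA; exact: idc.
Qed.

End Duality.

Arguments dual R {G} t.
Arguments plus_topology R {G} t.
Arguments s_u R {G} I u.

(* Main.v *)
From HB Require Import structures.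
Require Import Defs.
From mathcomp Require Import all_boot all_order all_algebra lra.
From mathcomp Require Import all_classical all_reals topology normedtype trigo.

(** Everything rests on the Comfort-Ross theorem: a totally bounded group
    topology [t] on an abelian group is [sigma (dual t)]. Granting it, every
    precompact topology in which [u] converges to [0] is coarser than
    [sigma (s_u I u)], which is itself totally bounded, makes [u] converge to
    [0], and is Hausdorff since [u] is a TB-sequence.

    Comfort-Ross is proved without Haar measure or spectral theory. For [h]
    bounded and uniformly continuous with [h 0 > 0], and [M] an invariant mean,
    the autocorrelation [c x = M_y (h y * h (y + x))] is positive definite. By a
    Krein-Milman argument, the functional [f |-> M (c * f)] attains its maximum
    over normalized positive definite functions at an extreme one, that is, at the
    real part [C] of a character of the discrete group [G]; the maximum is
    positive because [t] is totally bounded, and [C (y + x) + C (y - x) = 2 * C y * C x] then shows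
    that [C] is [t]-continuous. If a [t]-neighborhood [U] of [0] were not one for
    [sigma (dual t)], take [f] uniformly continuous with [f 0 = 1] and [f = 0]
    off [U], and an ultrafilter off [U] converging to [0] in [sigma (dual t)];
    the limit [g] of the translates of [f] along it has the same Fourier
    coefficients as [f] at continuous characters, and [h = f - g] gives a
    contradiction. *)

Set Implicit Arguments.
Unset Strict Implicit.
Unset Printing Implicit Defensive.

Import Order.TTheory GRing.Theory Num.Theory.
Import numFieldNormedType.Exports.

Local Open Scope classical_set_scope.
Local Open Scope ring_scope.

Local Notation space := Defs.space.

(** * Invariant means *)

Section UltraLimits.
Variables (R : realType) (T : Type) (F : set_system T).
Hypothesis UF : UltraFilter F.

Lemma ultra_bounded_cvg (w : T -> R) (B : R) :
  F [set i | `|w i| <= B] -> cvg (w @ F).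
Proof.
move=> FB.
have wB : (w @ F) `[- B, B]%classic.
  by apply: (filterS (F := F)) FB => i /=; rewrite ler_norml in_itv.
have [p [_ clp]] := @segment_compact R (- B) B (w @ F) _ wB.
apply/cvg_ex; exists p => N nN.
have [//|FnN] := in_ultra_setVsetC (w @^-1` N) UF.
by have [x []] := clp (~` N) N FnN nN.
Qed.

End UltraLimits.

Section Means.
Variables (R : realType) (G : zmodType).
Implicit Types (w v th : G -> R) (s : seq G).

Definition bounded_fct w := exists B : R, forall x, `|w x| <= B.

Definition avg s w : R := (\sum_(x <- s) w x) / (size s)%:R.

(** Averages over all differences of entries of [s]: on these, positive definite functions satisfy
    one-sided bounds. *)
Definition sqavg s w : R := avg s (fun x => avg s (fun y => w (x - y))).

Definition sumset s t : seq G := [seq x + y | x <- s, y <- t].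

(** Positivity with real coefficients alone does not imply the symmetry. *)
Definition pos_def (th : G -> R) : Prop :=
  (forall x, th (- x) = th x) /\
  forall l : seq (R * G),
    0 <= \sum_(p <- l) \sum_(q <- l) p.1 * q.1 * th (p.2 - q.2).

Lemma avgD s v w : avg s (fun x => v x + w x) = avg s v + avg s w.
Proof. by rewrite /avg big_split mulrDl. Qed.

Lemma avgZ s a w : avg s (fun x => a * w x) = a * avg s w.
Proof. by rewrite /avg -big_distrr mulrA. Qed.

Lemma avg_cst s a : s != [::] -> avg s (fun=> a) = a.
Proof.
move=> s0; rewrite /avg big_const_seq count_predT iter_addr_0.
by rewrite -[X in X / _]mulr_natr mulfK// pnatr_eq0 size_eq0.
Qed.

Lemma avg_le s v w : (forall x, v x <= w x) -> avg s v <= avg s w.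
Proof. by move=> vw; rewrite ler_wpM2r ?invr_ge0// ler_sum. Qed.

Lemma avg_sumset s t w :
  avg (sumset s t) w = avg s (fun x => avg t (fun y => w (x + y))).
Proof.
rewrite /avg /sumset big_allpairs_dep size_allpairs natrM invfM.
rewrite big_distrl /= big_distrl /=; apply: eq_bigr => x _.
by rewrite mulrA mulrAC.
Qed.

Lemma avg_exchange s t (f : G -> G -> R) :
  avg s (fun x => avg t (f x)) = avg t (fun y => avg s (f^~ y)).
Proof.
rewrite /avg -!big_distrl /= exchange_big /= -!mulrA [_^-1 * _]mulrC.
by rewrite big_distrl.
Qed.


Lemma sqavg_sumset s t w : sqavg (sumset s t) w =
  sqavg s (fun x => sqavg t (fun y => w (x + y))).
Proof.
rewrite /sqavg avg_sumset; congr avg; apply/funext => x.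
under eq_fun do rewrite avg_sumset.
rewrite avg_exchange; congr avg; apply/funext => x'.
congr avg; apply/funext => y; congr avg; apply/funext => y'.
by rewrite opprD addrACA.
Qed.

(** The two lists agree only up to order, so commutativity is stated for averages. *)
Lemma sqavg_sumsetC s t w : sqavg (sumset s t) w = sqavg (sumset t s) w.
Proof.
rewrite /sqavg !avg_sumset avg_exchange; congr avg; apply/funext => x.
congr avg; apply/funext => y; rewrite !avg_sumset avg_exchange.
congr avg; apply/funext => x'; congr avg; apply/funext => y'.
by rewrite (addrC x) (addrC x').
Qed.

Lemma sqavg_sumsetA s t r w :
  sqavg (sumset s (sumset t r)) w = sqavg (sumset (sumset s t) r) w.
Proof.
rewrite !sqavg_sumset; congr sqavg; apply/funext => x; rewrite sqavg_sumset.
by congr sqavg; apply/funext => y; congr sqavg; apply/funext => z; rewrite addrA.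
Qed.

Lemma sqavgD s v w : sqavg s (fun x => v x + w x) = sqavg s v + sqavg s w.
Proof. by rewrite /sqavg -avgD; congr avg; apply/funext => x; rewrite avgD. Qed.

Lemma sqavgZ s a w : sqavg s (fun x => a * w x) = a * sqavg s w.
Proof. by rewrite /sqavg -avgZ; congr avg; apply/funext => x; rewrite avgZ. Qed.

Lemma sqavg_cst s a : s != [::] -> sqavg s (fun=> a) = a.
Proof. by move=> s0; rewrite /sqavg avg_cst// avg_cst. Qed.

Lemma sqavg_le s v w : (forall x, v x <= w x) -> sqavg s v <= sqavg s w.
Proof. by move=> vw; apply: avg_le => x; apply: avg_le. Qed.

Lemma sqavg_norm s w (B : R) : s != [::] -> (forall x, `|w x| <= B) ->
  `|sqavg s w| <= B.
Proof.
move=> s0 wB; rewrite ler_norml -{1}(sqavg_cst (- B) s0) -{2}(sqavg_cst B s0).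
by apply/andP; split; apply: sqavg_le => x; have := wB x; rewrite ler_norml => /andP[].
Qed.

(** Positive definiteness is tested with coefficient 1 on [s] and -1 on [s] shifted by [- x]; each
    of the two cross terms is minus the shifted sum, one of them by symmetry of [th]. *)
Lemma pos_def_sqavg th s x : pos_def th ->
  sqavg s (fun y => th (x + y)) <= sqavg s th.
Proof.
move=> [thN thP].
have := thP ([seq (1, z) | z <- s] ++ [seq (- 1, z - x) | z <- s]).
rewrite big_cat !big_map /=.
under eq_bigr do rewrite big_cat !big_map /=.
rewrite big_split /=.
under [X in _ + X]eq_bigr do rewrite big_cat !big_map /=.
rewrite [X in _ + X]big_split /=.
pose S (w : G -> R) := \sum_(y <- s) \sum_(z <- s) w (y - z).
have -> : \sum_(i <- s) \sum_(j <- s) 1 * 1 * th (i - j) = S th.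
  by apply: eq_bigr => i _; apply: eq_bigr => j _; rewrite !mul1r.
have -> : \sum_(i <- s) \sum_(j <- s) -1 * -1 * th (i - x - (j - x)) = S th.
  apply: eq_bigr => i _; apply: eq_bigr => j _.
  by rewrite mulrNN !mul1r opprB addrA subrK.
have -> : \sum_(i <- s) \sum_(j <- s) 1 * -1 * th (i - (j - x)) =
    - S (fun y => th (x + y)).
  rewrite /S -sumrN; apply: eq_bigr => i _; rewrite -sumrN; apply: eq_bigr => j _.
  by rewrite mul1r mulN1r opprB addrCA.
have -> : \sum_(i <- s) \sum_(j <- s) -1 * 1 * th (i - x - j) =
    - S (fun y => th (x + y)).
  rewrite /S -sumrN exchange_big; apply: eq_bigr => i _ /=.
  rewrite -sumrN; apply: eq_bigr => j _.
  by rewrite mulr1 mulN1r -[in LHS]thN !opprD !opprK (addrC (- j)) -addrA (addrC (- j)).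
have E w : sqavg s w = S w / (size s)%:R / (size s)%:R.
  by rewrite /sqavg /avg -big_distrl.
move=> h; rewrite !E !ler_wpM2r ?invr_ge0//; lra.
Qed.

(** Adding further lists only lowers the average of a positive definite function, so the limit
    defining the mean lies below every [sqavg t th]. *)
Lemma sqavg_sumset_pos_def th s t : pos_def th -> s != [::] ->
  sqavg (sumset s t) th <= sqavg t th.
Proof.
move=> thP s0; rewrite sqavg_sumset -[leRHS](sqavg_cst _ s0).
by apply: sqavg_le => x; exact: pos_def_sqavg.
Qed.

(** Telescoping along the progression [0, u, ..., (n - 1) u]. *)
Lemma sqavg_shift s u n w (B : R) : s != [::] -> (forall x, `|w x| <= B) ->
  `|sqavg (sumset s [seq u *+ i | i <- iota 0 n.+1]) (fun x => w (x + u) - w x)|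
    <= B *+ 2 / n.+1%:R.
Proof.
move=> s0 wB; rewrite sqavg_sumset; apply: sqavg_norm => // x.
rewrite /sqavg avg_exchange; set P := map _ _.
have P0 : P != [::] by [].
have B0 : 0 <= B by exact: le_trans (wB 0).
set b := B *+ 2 / _.
have H y : `|avg P (fun x0 => w (x + (x0 - y) + u) - w (x + (x0 - y)))| <= b.
  rewrite /avg big_map size_map size_iota normrM [X in _ * X]ger0_norm ?invr_ge0//.
  rewrite ler_wpM2r ?invr_ge0// -[iota 0 n.+1]/(index_iota 0 n.+1).
  pose f i := w (x + (u *+ i - y)).
  have -> : \sum_(0 <= i < n.+1) (w (x + (u *+ i - y) + u) - w (x + (u *+ i - y)))
    = \sum_(0 <= i < n.+1) (f i.+1 - f i).
    by apply: eq_bigr => i _; rewrite /f mulrSr -!addrA (addrC (- y)).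
  rewrite telescope_sumr// mulr2n; apply: le_trans (ler_normB _ _) _.
  by apply: lerD; exact: wB.
rewrite ler_norml -{1}(avg_cst (- b) P0) -{2}(avg_cst b P0).
by apply/andP; split; apply: avg_le => y; have := H y; rewrite ler_norml => /andP[].
Qed.

(** The last two fields make [M th] the infimum of the finite averages [sqavg s th] when [th] is
    bounded and positive definite. This is the source of upper semicontinuity for pointwise
    convergence. *)
Record invariant_mean (M : (G -> R) -> R) : Prop := InvariantMean {
  meanD : forall v w, bounded_fct v -> bounded_fct w ->
    M (fun x => v x + w x) = M v + M w;
  meanZ : forall a w, bounded_fct w -> M (fun x => a * w x) = a * M w;
  mean_cst : forall a, M (fun=> a) = a;
  mean_le : forall v w, bounded_fct v -> bounded_fct w ->
    (forall x, v x <= w x) -> M v <= M w;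
  mean_shift : forall u w, bounded_fct w -> M (fun x => w (x + u)) = M w;
  mean_le_sqavg : forall th s, bounded_fct th -> pos_def th -> s != [::] ->
    M th <= sqavg s th;
  mean_ge_sqavg : forall w r, bounded_fct w ->
    (forall s, s != [::] -> r <= sqavg s w) -> r <= M w }.

(** The mean is a limit of the functionals [sqavg s] along an ultrafilter for which [s] eventually
    absorbs any given list as a summand. *)
Lemma invariant_mean_exists : exists M, invariant_mean M.
Proof.
pose F : set_system ((G -> R) -> R) := filter_from [set s | s != [::]]
  (fun s0 => [set sqavg (sumset s s0) | s in [set s | s != [::]]]).
have sumset0 s t : s != [::] -> t != [::] -> sumset s t != [::].
  by case: s t => // a s [].
have PF : ProperFilter F.
  apply: filter_from_proper; last first.
    by move=> s s0; exists (sqavg (sumset s s)); exists s.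
  apply: filter_from_filter; first by exists [:: 0].
  (* Since addition of lists is commutative and associative for [sqavg], a list with summand [s + t]
     has both [s] and [t] as summands. *)
  move=> s t s0 t0; exists (sumset s t); first exact: sumset0.
  move=> _ [r r0 <-]; split.
    exists (sumset r t); first exact: sumset0.
    apply/funext => w; rewrite -!sqavg_sumsetA !(sqavg_sumset r).
    by congr sqavg; apply/funext => x; rewrite sqavg_sumsetC.
  by exists (sumset r s); [exact: sumset0|apply/funext => w; rewrite sqavg_sumsetA].
have [U [UU FU]] := ultraFilterLemma PF.
have Fsq s0 (P : ((G -> R) -> R) -> Prop) : s0 != [::] ->
    (forall s, s != [::] -> P (sqavg (sumset s s0))) -> U [set m | P m].
  move=> s00 Ps; apply: FU; exists s0 => //.
  by move=> _ [s s1 <-]; exact: Ps.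
have cvgU w : bounded_fct w -> m w @[m --> U] --> lim (m w @[m --> U]).
  move=> [B wB]; apply: (@ultra_bounded_cvg _ _ _ _ _ B).
  apply: (Fsq [:: 0]) => // s s0; apply: sqavg_norm => //; exact: sumset0.
have limE (f : ((G -> R) -> R) -> R) (l : R) : f @ U --> l -> lim (f @ U) = l.
  by move=> h; apply: cvg_lim => //; exact: Rhausdorff.
have Fsq' (P : ((G -> R) -> R) -> Prop) :
    (forall s, s != [::] -> P (sqavg s)) -> U [set m | P m].
  by move=> h; apply: (Fsq [:: 0]) => // s s0; apply/h/sumset0.
have cvg_eq (f g : ((G -> R) -> R) -> R) (l : R) :
    (forall s, s != [::] -> f (sqavg s) = g (sqavg s)) -> f @ U --> l -> g @ U --> l.
  move=> fg; apply: cvg_trans; apply: near_eq_cvg.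
  exact: (Fsq' (fun m => f m = g m)).
exists (fun w => lim (m w @[m --> U])); split.
- move=> v w bv bw; apply: limE; apply: cvg_eq (cvgD (cvgU _ bv) (cvgU _ bw)) => s _.
  by rewrite sqavgD.
- move=> a w bw; apply: limE; apply: cvg_eq (cvgMr (cvgU _ bw)) => s _.
  by rewrite sqavgZ.
- move=> a; apply: limE; apply: cvg_eq (@cvg_cst _ _ _ U _) => s s0.
  by rewrite sqavg_cst.
- move=> v w bv bw vw; rewrite -subr_ge0.
  rewrite -(limE _ _ (cvgB (cvgU _ bw) (cvgU _ bv))).
  apply: limr_ge; first by apply/cvg_ex; eexists; exact: cvgB (cvgU _ bw) (cvgU _ bv).
  apply: (Fsq' (fun m => 0 <= m w - m v)) => s _.
  by rewrite subr_ge0 sqavg_le.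
- move=> u w bw; apply: limE.
  have [B wB] := bw.
  have B0 : 0 <= B by exact: le_trans (wB 0).
  apply/cvgrPdist_le => e e0.
  have [n nP] : exists n, B *+ 2 / n.+1%:R <= e / 2.
    exists (Num.truncn (B *+ 2 / (e / 2))).
    rewrite ler_pdivrMr// mulrC -ler_pdivrMr ?divr_gt0//.
    by rewrite ltW// truncnS_gt.
  have : U [set m | `|m (fun x => w (x + u)) - m w| <= e / 2].
    (* Absorbing a long progression of step [u] makes the functional almost invariant under
       translation by [u]. *)
    apply: (Fsq [seq u *+ i | i <- iota 0 n.+1]) => // s s0.
    have := sqavg_shift u n s0 wB; set s' := sumset _ _.
    have -> : sqavg s' (fun x => w (x + u) - w x) =
        sqavg s' (fun x => w (x + u)) - sqavg s' w.
      rewrite -mulN1r -sqavgZ -sqavgD; congr sqavg.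
      by apply/funext => x; rewrite mulN1r.
    by move=> /le_trans; apply.
  have /cvgrPdist_le/(_ (e / 2)) := cvgU _ bw.
  rewrite divr_gt0// => /(_ isT); apply: filterS2 => m /=.
  rewrite !ler_norml; lra.
- move=> th s bth thP s0; apply: limr_le; first by apply/cvg_ex; eexists; exact: cvgU.
  by apply: (Fsq s (fun m => m th <= sqavg s th)) => // t t0; exact: sqavg_sumset_pos_def.
- move=> w r bw wr; apply: limr_ge; first by apply/cvg_ex; eexists; exact: cvgU.
  exact: (Fsq' (fun m => r <= m w)).
Qed.

End Means.

(** * Extreme points *)

Section BauerMaximum.
Variables (R : realType) (K : Type).
Implicit Types (X Y : set (K -> R)) (f : K -> R) (L : (K -> R) -> R).

Definition ptlim (F : set_system (K -> R)) (x : K) : R :=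
  lim ((fun f => f x) @ F).

(** Compactness in the product topology, for sets of uniformly bounded
    functions, phrased with pointwise limits along ultrafilters. *)
Definition ultraclosed X := forall F, UltraFilter F -> F X -> X (ptlim F).

Definition convex_comb (a : R) f f' : K -> R :=
  fun x => a * f x + (1 - a) * f' x.

Variable P : set (K -> R).
Hypothesis P_bounded : forall f x, P f -> `|f x| <= 1.
Hypothesis P_closed : ultraclosed P.

(** Only the first endpoint is required to lie in [X]; the second follows by exchanging [a] with
    [1 - a]. *)
Definition face X : Prop :=
  [/\ X `<=` P, X !=set0, ultraclosed X &
      forall f f' (a : R), P f -> P f' -> 0 < a < 1 -> X (convex_comb a f f') -> X f].

Lemma convex_combC a f f' : convex_comb a f f' = convex_comb (1 - a) f' f.
Proof. by apply/funext => x; rewrite /convex_comb subKr addrC. Qed.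

Lemma ptlim_cvg F x : UltraFilter F -> F P -> (fun f => f x) @ F --> ptlim F x.
Proof.
move=> UF FP; apply: (@ultra_bounded_cvg _ _ _ UF _ 1).
by apply: filterS FP => f; exact: P_bounded.
Qed.

(** The pointwise limit along an ultrafilter containing every member of the chain lies in all of
    them. *)
Lemma bigcap_chain_neq0 (C : set (set (K -> R))) : C !=set0 ->
  total_on C subset -> (forall X, C X -> X !=set0 /\ ultraclosed X) ->
  \bigcap_(X in C) X !=set0.
Proof.
move=> C0 tC CX; pose F := filter_from C id.
have PF : ProperFilter F.
  apply: filter_from_proper; last by move=> X /CX[].
  apply: filter_from_filter => // X Y CX' CY.
  by case: (tC _ _ CX' CY) => XY; [exists X|exists Y] => // f Xf; split => //; exact: XY.
have [U [UU FU]] := ultraFilterLemma PF.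
exists (ptlim U) => X CX'; apply: (CX _ CX').2 => //.
by apply: FU; exists X.
Qed.

Definition usc_affine L : Prop :=
  [/\ forall f f' (a : R), P f -> P f' -> 0 < a < 1 ->
        L (convex_comb a f f') = a * L f + (1 - a) * L f',
      forall r, ultraclosed [set f | P f /\ r <= L f] &
      exists B, forall f, P f -> L f <= B].

Lemma eval_usc_affine x : usc_affine (fun f => f x).
Proof.
split=> // [r F UF FX|].
  have FP : F P by apply: filterS FX => f [].
  split; first exact: P_closed.
  apply: limr_ge; first by apply/cvg_ex; eexists; exact: ptlim_cvg.
  by apply: (filterS (F := F)) FX => f [].
by exists 1 => f /(P_bounded x)/(le_trans (ler_norm _)).
Qed.

(** By compactness the superlevel sets below the supremum have a common point, so the supremum is
    attained. Affinity forces both endpoints of a segment through a maximizer to be maximizers. *)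
Lemma face_maximizers X L : face X -> usc_affine L ->
  exists2 m, (forall f, X f -> L f <= m) & face [set f | X f /\ m <= L f].
Proof.
move=> [XP [f0 Xf0] Xcl Xface] [Laff Lusc [B LB]].
pose E := [set L f | f in X].
have supE : has_sup E.
  by split; [exists (L f0), f0|exists B => _ [f Xf <-]; exact/LB/XP].
have Lm f : X f -> L f <= sup E.
  by move=> Xf; apply: sup_upper_bound => //; exists f.
exists (sup E) => //; split=> [f []|||].
- by move=> + _; exact: XP.
- pose C := [set Y | exists2 r, r < sup E & Y = [set f | X f /\ r <= L f]].
  have [|||f fC] := @bigcap_chain_neq0 C.
  + by exists [set f | X f /\ sup E - 1 <= L f], (sup E - 1) => //; rewrite gtrBl.
  + move=> _ _ [r _ ->] [r' _ ->]; have [rr'|r'r] := leP r r'; [right|left].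
      by move=> f /= [Xf ?]; split=> //; exact: le_trans rr' _.
    by move=> f /= [Xf ?]; split=> //; exact: le_trans (ltW r'r) _.
  + move=> _ [r rE ->]; split.
      have [|_ [f Xf <-]] := @sup_adherent _ E (sup E - r) _ supE.
        by rewrite subr_gt0.
      by rewrite subKr => /ltW rL; exists f.
    move=> F UF FX; have FXX : F X by apply: filterS FX => f [].
    split; first exact: Xcl.
    have [|//] := Lusc r F UF.
    by apply: filterS FX => f [/XP Pf].
  + exists f; split.
      have [|//] := fC [set f | X f /\ sup E - 1 <= L f].
      by exists (sup E - 1) => //; rewrite gtrBl.
    rewrite leNgt; apply/negP => Lf.
    (* The midpoint is a level below the supremum that [f] would fail to reach. *)
    have /= [|_] := fC [set g | X g /\ (L f + sup E) / 2 <= L g].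
      by exists ((L f + sup E) / 2) => //; lra.
    lra.
- move=> F UF FX; have FXX : F X by apply: filterS FX => f [].
  split; first exact: Xcl.
  have [|//] := Lusc (sup E) F UF.
  by apply: filterS FX => f [/XP Pf].
- move=> f f' a Pf Pf' a01 [Xff'].
  have Xf : X f by exact: Xface Xff'.
  have /andP[a0 a1] := a01.
  have Xf' : X f'.
    by rewrite convex_combC in Xff'; apply: Xface Xff' => //; apply/andP; split; lra.
  rewrite Laff// => h; split => //.
  rewrite -(ler_pM2l a0).
  have : (1 - a) * L f' <= (1 - a) * sup E by rewrite ler_wpM2l ?Lm// subr_ge0 ltW.
  lra.
Qed.

(** Zorn's lemma for reverse inclusion gives a minimal face. Maximizing an evaluation on it cannot
    shrink it, so every evaluation is constant there and the face is a single point. *)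
Lemma face_has_extreme X : face X -> exists2 f, X f & face [set f].
Proof.
move=> faceX; pose T := {Y | face Y /\ Y `<=` X}.
pose toT Y YP : T := exist (fun Y => face Y /\ Y `<=` X) Y YP.
pose le (Y Z : T) := `[< sval Z `<=` sval Y >].
have [|||A tA|[Y [fY YX]] Ymin] := @Zorn T le.
- by move=> Y; apply/asboolP.
- by move=> Y Z W /asboolP YZ /asboolP ZW; apply/asboolP; exact: subset_trans YZ.
- move=> [Y pY] [Z pZ] /asboolP /= YZ /asboolP /= ZY.
  exact/eq_exist/seteqP.
- have [[Y0 AY0]|A0] := pselect (A !=set0); last first.
    have XX : face X /\ X `<=` X by split.
    by exists (toT X XX) => Y AY; exfalso; apply: A0; exists Y.
  pose C := [set sval Y | Y in A].
  have faceC : face (\bigcap_(Y in C) Y) /\ \bigcap_(Y in C) Y `<=` X.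
    have CX : \bigcap_(Y in C) Y `<=` X.
      by apply: subset_trans (proj2 (svalP Y0)) => f; apply; exists Y0.
    split=> //; split.
    + by apply: (subset_trans CX); case: faceX.
    + apply: bigcap_chain_neq0; first by exists (sval Y0), Y0.
        move=> _ _ [Y AY <-] [Z AZ <-].
        by have [/asboolP|/asboolP] := tA _ _ AY AZ; [right|left].
      by move=> _ [Y AY <-]; case: (proj1 (svalP Y)).
    + move=> F UF FC _ [Y AY <-]; case: (proj1 (svalP Y)) => _ _ + _; apply => //.
      by apply: filterS FC => f; apply; exists Y.
    + move=> f f' a Pf Pf' a01 h _ [Y AY <-].
      case: (proj1 (svalP Y)) => _ _ _ /(_ f f' a Pf Pf' a01); apply.
      by apply: h; exists Y.
  exists (toT _ faceC) => Y AY; apply/asboolP => /= f; apply.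
  by exists Y.
- have [_ [f Yf] _ _] := fY.
  exists f; first by have := YX f Yf.
  suff -> : [set f] = Y by [].
  apply/seteqP; split=> [_ -> //|g Yg].
  apply/funext => x.
  have [m Ym faceYm] := face_maximizers fY (eval_usc_affine x).
  have YmX : face [set f | Y f /\ m <= f x] /\ [set f | Y f /\ m <= f x] `<=` X.
    by split=> // h [Yh _]; have := YX h Yh.
  have /(congr1 sval) /= YmE : toT _ YmX = toT Y (conj fY YX).
    by apply: Ymin; apply/asboolP => h [].
  have Yx h : Y h -> h x = m.
    move=> Yh; apply/eqP; rewrite eq_le Ym//=.
    by move: Yh; rewrite -[X in X h]YmE => -[].
  by rewrite !Yx.
Qed.

(** Faces are taken relative to [P], so an extreme point of the face of maximizers is extreme in
    [P]. *)
Lemma Bauer_maximum L : P !=set0 -> usc_affine L ->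
  exists f, [/\ P f, forall g, P g -> L g <= L f &
    forall g g' (a : R), P g -> P g' -> 0 < a < 1 -> f = convex_comb a g g' -> g = f].
Proof.
move=> P0 affL; have faceP : face P by split.
have [m Lm faceM] := face_maximizers faceP affL.
have [f [Pf mf] [_ _ _ facef]] := face_has_extreme faceM.
exists f; split=> // [g Pg|g g' a Pg Pg' a01 fE]; first exact: le_trans (Lm _ Pg) mf.
by apply: facef Pg Pg' a01 _; rewrite -fE.
Qed.

End BauerMaximum.

(** * Positive definite functions *)

Lemma cvg_sumr (R : realType) (T : Type) (F : set_system T) (J : Type)
    (s : seq J) (f : J -> T -> R) (l : J -> R) : Filter F ->
  (forall j, f j @ F --> l j) ->
  (fun x => \sum_(j <- s) f j x) @ F --> \sum_(j <- s) l j.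
Proof.
move=> FF fl; elim: s => [|j s IH].
  by rewrite big_nil; under eq_fun do rewrite big_nil; exact: cvg_cst.
by rewrite big_cons; under eq_fun do rewrite big_cons; exact: cvgD.
Qed.

Section PositiveDefinite.
Variables (R : realType) (G : zmodType).
Implicit Types (f th : G -> R).

Lemma pos_def_norm_le th x : pos_def th -> `|th x| <= th 0.
Proof.
move=> [thN thP]; have H e : e * e = 1 -> 0 <= th 0 + e * th x.
  move=> e1; have := thP [:: (1, x); (e, 0)].
  rewrite !big_cons !big_nil /= !addr0 !subr0 sub0r !subrr thN e1 !mul1r mulr1.
  lra.
have := H 1 (mul1r _); have := H (- 1) (etrans (mulrNN 1 1) (mul1r 1)).
rewrite ler_norml; lra.
Qed.

Lemma pos_def_scale th c : 0 <= c -> pos_def th -> pos_def (fun x => c * th x).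
Proof.
move=> c0 [thN thP]; split=> [x|l]; first by rewrite thN.
have -> : \sum_(p <- l) \sum_(q <- l) p.1 * q.1 * (c * th (p.2 - q.2)) =
    c * \sum_(p <- l) \sum_(q <- l) p.1 * q.1 * th (p.2 - q.2).
  rewrite big_distrr; apply: eq_bigr => p _; rewrite big_distrr.
  by apply: eq_bigr => q _ /=; rewrite mulrCA.
by rewrite mulr_ge0.
Qed.

Lemma pos_def_restrict (K : zmodType) (j : G -> K) (f : K -> R) :
  {morph j : x y / x - y} -> pos_def f -> pos_def (f \o j).
Proof.
move=> jB [fN fP]; split=> [x|l] /=.
  have j0 : j 0 = 0 by have := jB 0 0; rewrite !subrr.
  by rewrite -sub0r jB j0 sub0r fN.
have := fP [seq (p.1, j p.2) | p <- l]; rewrite big_map.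
congr (_ <= _); apply: eq_bigr => p _; rewrite big_map.
by apply: eq_bigr => q _ /=; rewrite jB.
Qed.

Lemma pos_def_cst1 : pos_def (fun _ : G => 1 : R).
Proof.
split=> // l; under eq_bigr do under eq_bigr do rewrite mulr1.
by under eq_bigr do rewrite -big_distrr; rewrite -big_distrl /= -expr2 sqr_ge0.
Qed.

(** This is the quadratic form of [th] on a list completed by its translate by [u] with weights
    multiplied by [e]. *)
Lemma pos_def_translates th u e : e * e = 1 -> pos_def th ->
  pos_def (fun x => 2 * th x + e * (th (x + u) + th (x - u))).
Proof.
move=> e1 [thN thP]; split=> [x|l].
  by rewrite thN (addrC (- x) u) -(opprB x) -opprD !thN (addrC (th (x - u))).
have := thP (l ++ [seq (e * p.1, p.2 + u) | p <- l]).
rewrite big_cat big_map /=.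
under eq_bigr do rewrite big_cat big_map /=.
under [X in _ + X]eq_bigr do rewrite big_cat big_map /=.
rewrite -big_split /=; congr (_ <= _).
apply: eq_bigr => p _; rewrite -!big_split /=; apply: eq_bigr => q _.
rewrite opprD !addrA (addrAC p.2 u) addrK (addrAC p.2 (- q.2)) -mulrA.
rewrite [e * p.1 * (e * q.1)]mulrACA e1 mul1r.
lra.
Qed.

End PositiveDefinite.

(** * Extreme normalized positive definite functions and d'Alembert's equation *)

Section Normalized.
Variables (R : realType) (K : zmodType) (i : K).

(** For [K = G * R] and [i = (0, pi / 2)], [f] stands for the complex-valued
    function on [G] whose real part after multiplication by [expi r] is
    [f (_, r)]: this keeps all positive definite functions real. *)
Definition normalized_pos_def : set (K -> R) :=
  [set f | [/\ pos_def f, f 0 = 1 & forall x, f (x + i + i) = - f x]].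

Lemma normalized_pos_def_bounded f x : normalized_pos_def f -> `|f x| <= 1.
Proof. by move=> [fP <- _]; exact: pos_def_norm_le. Qed.

Lemma normalized_pos_def_closed : ultraclosed normalized_pos_def.
Proof.
move=> F UF FP.
have Fcvg x : (fun f => f x) @ F --> ptlim F x.
  by apply: ptlim_cvg FP; exact: normalized_pos_def_bounded.
have lin x y a b : (forall f, normalized_pos_def f -> f x = a * f y + b) ->
    ptlim F x = a * ptlim F y + b.
  move=> fxy; have h : (fun f => a * f y + b) @ F --> a * ptlim F y + b.
    by apply: cvgD; [apply: cvgMr; exact: Fcvg|exact: cvg_cst].
  apply: (cvg_unique (@Rhausdorff R) (Fcvg x)); apply: cvg_trans h.
  by apply: near_eq_cvg; apply: filterS FP => f; move=> Pf; rewrite (fxy f Pf).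
split; first split.
- move=> x; rewrite (lin (- x) x 1 0) ?mul1r ?addr0// => f [[-> _] _ _].
  by rewrite mul1r addr0.
- move=> l; have h : (fun f : K -> R =>
      \sum_(p <- l) \sum_(q <- l) p.1 * q.1 * f (p.2 - q.2)) @ F -->
      \sum_(p <- l) \sum_(q <- l) p.1 * q.1 * ptlim F (p.2 - q.2).
    by apply: cvg_sumr => p; apply: cvg_sumr => q; apply: cvgMr; exact: Fcvg.
  rewrite -(cvg_lim (@Rhausdorff R) h); apply: limr_ge.
    by apply/cvg_ex; eexists; exact: h.
  by apply: filterS FP => f [[_ +] _ _]; exact.
- by rewrite (lin 0 0 0 1) ?mul0r ?add0r// => f [_ -> _]; rewrite mul0r add0r.
- move=> x; rewrite (lin (x + i + i) x (- 1) 0) ?mulN1r ?addr0// => f [_ _ ->].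
  by rewrite mulN1r addr0.
Qed.

(** With weights [(1 + f u) / 2] and [(1 - f u) / 2], [f] is a convex combination of the normalized
    [g 1] and [g (-1)]. Extremality identifies [f] with the first, which is the equation. *)
Lemma extreme_dAlembert f : normalized_pos_def f ->
  (forall g g' (a : R), normalized_pos_def g -> normalized_pos_def g' ->
    0 < a < 1 -> f = convex_comb a g g' -> g = f) ->
  forall x u, f (x + u) + f (x - u) = 2 * (f x * f u).
Proof.
move=> [fP f0 fi] fext x u; have [fN _] := fP.
pose g e y := 2 * f y + e * (f (y + u) + f (y - u)).
have gP e : e * e = 1 -> pos_def (g e) by move=> e1; exact: pos_def_translates.
have g0 e : g e 0 = 2 + e * (2 * f u).
  by rewrite /g f0 add0r sub0r fN mulr1 mulr_natl mulr2n.
have gi e y : g e (y + i + i) = - g e y.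
  rewrite /g fi !(addrAC _ i u) !(addrAC _ i (- u)) !fi; lra.
have NN : (-1) * (-1) = 1 :> R by rewrite mulrNN mul1r.
have degenerate e : e * e = 1 -> g e 0 = 0 -> g e x = 0.
  move=> e1 ge0; have := pos_def_norm_le x (gP e e1).
  by rewrite ge0 normr_le0 => /eqP.
(* If [f u] is 1 or -1, one of the two functions vanishes at 0, hence everywhere, and this already
   gives the equation. *)
have [fu1|fu1] := eqVneq (f u) 1.
  by have := degenerate (-1) NN; rewrite g0 /g fu1 => /(_ ltac:(lra)); lra.
have [fuN1|fuN1] := eqVneq (f u) (-1).
  by have := degenerate 1 (mul1r _); rewrite g0 /g fuN1 => /(_ ltac:(lra)); lra.
have := pos_def_norm_le u fP; rewrite f0 ler_norml => /andP[fu_ge fu_le].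
have {fu_ge fuN1}fu_gt : -1 < f u by rewrite lt_neqAle eq_sym fuN1.
have {fu_le fu1}fu_lt : f u < 1 by rewrite lt_neqAle fu1.
have gnP e : e * e = 1 -> 0 < g e 0 ->
    normalized_pos_def (fun y => (g e 0)^-1 * g e y).
  move=> e1 ge0; split; first by apply: pos_def_scale; [rewrite invr_ge0 ltW|exact: gP].
    by rewrite mulVf// gt_eqF.
  by move=> y; rewrite gi mulrN.
have g1 : 0 < g 1 0 by rewrite g0; lra.
have gN1 : 0 < g (-1) 0 by rewrite g0; lra.
have := fext _ _ ((1 + f u) / 2) (gnP _ (mul1r _) g1) (gnP _ NN gN1).
have -> : (g 1 0)^-1 = (1 + f u)^-1 / 2.
  by rewrite g0 -invfM; congr (_^-1); lra.
have -> : (g (-1) 0)^-1 = (1 - f u)^-1 / 2.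
  by rewrite g0 -invfM; congr (_^-1); lra.
have h1 : (1 + f u) * (1 + f u)^-1 = 1 by rewrite mulfV//; lra.
have hN1 : (1 - f u) * (1 - f u)^-1 = 1 by rewrite mulfV//; lra.
move=> /(_ _ _)/(congr1 (@^~ x)) => /(_ _ _)/= H.
have {H} : (1 + f u)^-1 / 2 * g 1 x = f x.
  apply: H; first by apply/andP; split; lra.
  apply/funext => y; rewrite /convex_comb.
  have -> : 1 - (1 + f u) / 2 = (1 - f u) / 2 by lra.
  rewrite /g; move: h1 hN1; set p := _^-1; set q := _^-1 => h1 hN1.
  set S := f (y + u) + _.
  transitivity (((1 + f u) * p * (2 * f y + S) + (1 - f u) * q * (2 * f y - S)) / 4).
    by rewrite h1 hN1; lra.
  lra.
move=> /(congr1 ( *%R (1 + f u))); rewrite !mulrA h1 /g; lra.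
Qed.

(** Translation by [i] is a quarter turn, so [f (x - i)] plays the sine to the cosine [f x]. *)
Lemma dAlembert_addition f : normalized_pos_def f ->
    (forall x u, f (x + u) + f (x - u) = 2 * (f x * f u)) ->
  [/\ forall x y, f (x + y) = f x * f y - f (x - i) * f (y - i),
      forall x y, f (x + y - i) = f (x - i) * f y + f x * f (y - i) &
      forall x, f x ^+ 2 + f (x - i) ^+ 2 = 1].
Proof.
move=> [_ f0 fi] fD.
have fi' x : f (x - i - i) = - f x.
  by have := fi (x - i - i); rewrite !subrK => ->; rewrite opprK.
have fSS x y : f (x - y) - f (x + y) = 2 * (f (x - i) * f (y - i)).
  have -> : x - y = x - i - (y - i) by rewrite opprB addrA subrK.
  by rewrite -fD -fi' addrC -addrA -opprD addrACA opprD.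
split=> [x y|x y|x].
- have := fD x y; have := fSS x y; lra.
- have := fD x (y - i); have := fD (x - i) y.
  rewrite (addrAC x (- i)) opprB !addrA (addrAC x i).
  have := fi (x - y - i); rewrite subrK (addrAC x (- i)) => ->; lra.
- have := fD x x; have := fSS x x; rewrite subrr f0 !expr2; lra.
Qed.

End Normalized.

(** * Autocorrelations *)

Section BoundedFunctions.
Variables (R : realType) (G : zmodType).
Implicit Types (v w : G -> R).

Lemma bounded_fct_cst a : bounded_fct (fun _ : G => a : R).
Proof. by exists `|a|. Qed.

Lemma bounded_fctD v w : bounded_fct v -> bounded_fct w ->
  bounded_fct (fun x => v x + w x).
Proof.
move=> [A vA] [B wB]; exists (A + B) => x.
by apply: le_trans (ler_normD _ _) _; apply: lerD.
Qed.

Lemma bounded_fctM v w : bounded_fct v -> bounded_fct w ->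
  bounded_fct (fun x => v x * w x).
Proof.
move=> [A vA] [B wB]; exists (A * B) => x.
by rewrite normrM ler_pM.
Qed.

Lemma bounded_fctN w : bounded_fct w -> bounded_fct (fun x => - w x).
Proof. by move=> [B wB]; exists B => x; rewrite normrN. Qed.

Lemma bounded_fct_shift w (k : G -> G) : bounded_fct w -> bounded_fct (w \o k).
Proof. by move=> [B wB]; exists B => x; exact: wB. Qed.

Lemma bounded_fct_sum (J : Type) (s : seq J) (f : J -> G -> R) :
  (forall j, bounded_fct (f j)) -> bounded_fct (fun x => \sum_(j <- s) f j x).
Proof.
move=> fB; elim: s => [|j s IH].
  by under eq_fun do rewrite big_nil; exact: bounded_fct_cst.
by under eq_fun do rewrite big_cons; exact: bounded_fctD.
Qed.

Variable M : (G -> R) -> R.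
Hypothesis mM : invariant_mean M.

Lemma mean_sum (J : Type) (s : seq J) (f : J -> G -> R) :
  (forall j, bounded_fct (f j)) ->
  M (fun x => \sum_(j <- s) f j x) = \sum_(j <- s) M (f j).
Proof.
move=> fB; elim: s => [|j s IH].
  by rewrite big_nil; under eq_fun do rewrite big_nil; exact: mean_cst.
rewrite big_cons -IH -(meanD mM)//; last exact: bounded_fct_sum.
by under eq_fun do rewrite big_cons.
Qed.

Lemma mean_norm_le w (B : R) : (forall x, `|w x| <= B) -> `|M w| <= B.
Proof.
move=> wB; have bw : bounded_fct w by exists B.
rewrite ler_norml -{1}(mean_cst mM (- B)) -{2}(mean_cst mM B).
by apply/andP; split; apply: (mean_le mM) => // [|x];
  by [exact: bounded_fct_cst|have := wB x; rewrite ler_norml => /andP[]].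
Qed.

Lemma mean_ge0 w : bounded_fct w -> (forall x, 0 <= w x) -> 0 <= M w.
Proof.
move=> bw w0; rewrite -[leLHS](mean_cst mM); apply: (mean_le mM) => //.
exact: bounded_fct_cst.
Qed.

Lemma meanB v w : bounded_fct v -> bounded_fct w ->
  M (fun x => v x - w x) = M v - M w.
Proof.
move=> bv bw; rewrite (meanD mM)//; last exact: bounded_fctN.
congr (_ + _); rewrite -mulN1r -(meanZ mM)//; congr M.
by apply/funext => x; rewrite mulN1r.
Qed.

Variable h : G -> R.
Hypothesis bh : bounded_fct h.

Definition autocorr (x : G) : R := M (fun y => h y * h (y + x)).

Let bhx x : bounded_fct (fun y => h (y + x)).
Proof. exact: bounded_fct_shift (fun y => y + x) bh. Qed.

Let bcorr x : bounded_fct (fun y => h y * h (y + x)).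
Proof. by apply: bounded_fctM. Qed.

Lemma autocorr_bounded : bounded_fct autocorr.
Proof.
have [B hB] := bh; exists (B * B) => x; apply: mean_norm_le => y.
by rewrite normrM ler_pM.
Qed.

Lemma autocorrB x y : autocorr (x - y) = M (fun z => h (z + x) * h (z + y)).
Proof.
rewrite /autocorr -(mean_shift mM y)//; congr M; apply/funext => z.
by rewrite mulrC -(addrA z y) (addrC y) subrK.
Qed.

(** A Schur product argument: the form is the mean over [z] of the form of [th] with coefficients
    multiplied by [h (z + p.2)]. *)
Lemma pos_def_autocorr_mul th : pos_def th ->
  pos_def (fun x => autocorr x * th x).
Proof.
move=> [thN thP]; split=> [x|l].
  rewrite thN; congr (_ * _).
  rewrite -sub0r autocorrB /autocorr; congr M; apply/funext => z.
  by rewrite addr0.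
have -> : \sum_(p <- l) \sum_(q <- l)
      p.1 * q.1 * (autocorr (p.2 - q.2) * th (p.2 - q.2)) =
    M (fun z => \sum_(p <- l) \sum_(q <- l)
      p.1 * q.1 * th (p.2 - q.2) * (h (z + p.2) * h (z + q.2))).
  have b1 (p q : R * G) : bounded_fct (fun z => h (z + p.2) * h (z + q.2)).
    by apply: bounded_fctM.
  have b2 (p q : R * G) : bounded_fct
      (fun z => p.1 * q.1 * th (p.2 - q.2) * (h (z + p.2) * h (z + q.2))).
    by apply: bounded_fctM => //; exact: bounded_fct_cst.
  rewrite mean_sum => [|p]; last exact: bounded_fct_sum.
  apply: eq_bigr => p _; rewrite mean_sum//; apply: eq_bigr => q _.
  by rewrite (meanZ mM) ?autocorrB; [lra|apply: bounded_fctM].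
apply: mean_ge0 => [|z].
  apply: bounded_fct_sum => p; apply: bounded_fct_sum => q.
  apply: bounded_fctM; first exact: bounded_fct_cst.
  by apply: bounded_fctM.
have := thP [seq (p.1 * h (z + p.2), p.2) | p <- l].
rewrite big_map; congr (_ <= _); apply: eq_bigr => p _; rewrite big_map.
apply: eq_bigr => q _ /=; lra.
Qed.

Lemma pos_def_autocorr : pos_def autocorr.
Proof.
have := pos_def_autocorr_mul (pos_def_cst1 R G).
by under [X in pos_def X]eq_fun do rewrite mulr1.
Qed.

Let K : zmodType := (G * R)%type.
Let i : K := (0, pi / 2).
Let j (x : G) : K := (x, 0).

Let jB : {morph j : x y / x - y}.
Proof. by move=> x y; rewrite /j; congr pair; rewrite subr0. Qed.

Let P := normalized_pos_def (R := R) i.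

(** Each product [autocorr x * f (j x)] is positive definite, so its mean is an infimum of finite
    averages, and these are continuous in [f] for pointwise convergence. *)
Lemma autocorr_functional_usc_affine :
  usc_affine P (fun f => M (fun x => autocorr x * f (j x))).
Proof.
have bP f : P f -> bounded_fct (f \o j).
  by move=> Pf; exists 1 => x; exact: normalized_pos_def_bounded Pf.
have bPM f : P f -> bounded_fct (fun x => autocorr x * f (j x)).
  by move=> /bP; exact: bounded_fctM autocorr_bounded.
split.
- have bZ c g : P g -> bounded_fct (fun x => c * (autocorr x * g (j x))).
    by move=> Pg; apply: bounded_fctM; [exact: bounded_fct_cst|exact: bPM].
  move=> f f' a Pf Pf' _; rewrite -(meanZ mM _ (bPM _ Pf)) -(meanZ mM _ (bPM _ Pf')).
  rewrite -(meanD mM (bZ _ _ Pf) (bZ _ _ Pf')).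
   congr M; apply/funext => x; rewrite /convex_comb; lra.
- move=> r F UF FX.
  have FP : F P by apply: filterS FX => f [].
  have Pl : P (ptlim F) by exact: normalized_pos_def_closed.
  split => //; apply: (mean_ge_sqavg mM); first exact: bPM.
  move=> s s0.
  have h' : (fun f : K -> R => sqavg s (fun x => autocorr x * f (j x))) @ F -->
      sqavg s (fun x => autocorr x * ptlim F (j x)).
    apply: cvgMl; apply: cvg_sumr => x; apply: cvgMl; apply: cvg_sumr => y.
    by apply: cvgMr; apply: ptlim_cvg FP => f z; exact: normalized_pos_def_bounded.
  rewrite -(cvg_lim (@Rhausdorff R) h'); apply: limr_ge.
    by apply/cvg_ex; eexists; exact: h'.
  apply: filterS FX => f [Pf /le_trans]; apply.
  apply: (mean_le_sqavg mM) => //; first exact: bPM.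
  by apply: pos_def_autocorr_mul; case: Pf => fP _ _; exact: pos_def_restrict jB fP.
- have [B cB] := autocorr_bounded; exists B => f Pf.
  apply: le_trans (ler_norm _) _; apply: mean_norm_le => x.
  rewrite normrM -[B]mulr1 ler_pM//; exact: normalized_pos_def_bounded Pf.
Qed.

Lemma autocorr_character : 0 < autocorr 0 -> 0 < M (fun x => autocorr x ^+ 2) ->
  exists C S : G -> R,
    [/\ forall x y, C (x + y) = C x * C y - S x * S y,
        forall x y, S (x + y) = S x * C y + C x * S y,
        forall x, C x ^+ 2 + S x ^+ 2 = 1 &
        0 < M (fun x => autocorr x * C x)].
Proof.
(* [f0] is the competitor showing that the maximum is positive: its value is the mean of the squared
   autocorrelation divided by [autocorr 0]. *)
move=> c0 c2; pose f0 : K -> R := fun z => (autocorr 0)^-1 * (autocorr z.1 * cos z.2).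
have [cN cP] := pos_def_autocorr.
have Pf0 : P f0.
  split; last first.
  - move=> z; rewrite /f0 /= !addr0; have -> : z.2 + pi / 2 + pi / 2 = z.2 + pi by lra.
    by rewrite cosDpi !mulrN.
  - by rewrite /f0 /= cos0 mulr1 mulVf// gt_eqF.
  apply: pos_def_scale; first by rewrite invr_ge0 ltW.
  split=> [z|l] /=; first by rewrite cN cosN.
  (* The formula for the cosine of a difference splits the form into two forms of [autocorr],
     weighted by cosines and by sines. *)
  pose T (e : R -> R) := [seq (p.1 * e p.2.2, p.2.1) | p <- l].
  have := addr_ge0 (cP (T cos)) (cP (T sin)).
  rewrite !big_map -big_split; congr (_ <= _); apply: eq_bigr => p _ /=.
  rewrite !big_map -big_split; apply: eq_bigr => q _ /=.
  rewrite cosB; lra.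
have [f [Pf fmax fext]] := Bauer_maximum (normalized_pos_def_bounded (i := i))
  (@normalized_pos_def_closed _ _ i) (ex_intro _ _ Pf0) autocorr_functional_usc_affine.
have [fC fS fCS] := dAlembert_addition Pf (extreme_dAlembert Pf fext).
have jD : {morph j : x y / x + y}.
  by move=> x y; rewrite /j; congr pair; rewrite addr0.
exists (f \o j), (fun x => f (j x - i)); split=> [x y|x y|x|] /=.
- by rewrite jD fC.
- by rewrite jD fS.
- exact: fCS.
apply: lt_le_trans (fmax _ Pf0).
have -> : (fun x => autocorr x * f0 (j x)) =
    (fun x => (autocorr 0)^-1 * autocorr x ^+ 2).
  by apply/funext => x; rewrite /f0 /= cos0 mulr1 mulrCA expr2.
rewrite (meanZ mM) ?mulr_gt0 ?invr_gt0//.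
by under eq_fun do rewrite expr2; apply: bounded_fctM; exact: autocorr_bounded.
Qed.

End BoundedFunctions.

(** * The circle *)

Section Circle.
Variable R : realType.
Local Notation tau := (pi *+ 2 : R).

Definition circle_proj (x : R) : circle R :=
  (\pi_(Quotient.quot (int_subgroup R)) x)%qT.
Definition circle_repr (q : circle R) : R := repr (q : Quotient.quot (int_subgroup R)).

Lemma circle_reprK : cancel circle_repr circle_proj.
Proof. by move=> q; rewrite /circle_proj /circle_repr reprK. Qed.

Lemma circle_projB x y : circle_proj (x - y) = circle_proj x - circle_proj y.
Proof. exact: raddfB. Qed.

Lemma circle_proj0 : circle_proj 0 = 0.
Proof. by rewrite -(subrr 0) circle_projB subrr. Qed.

Lemma circle_proj_continuous : continuous circle_proj.
Proof. exact: pi_continuous. Qed.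

Lemma circle_proj_eq x y : (circle_proj x == circle_proj y) = (x - y \is a Num.int).
Proof.
rewrite -[RHS]/(x - y \in int_subgroup R) Quotient.idealrBE.
by apply/eqP/eqP.
Qed.

Lemma cos_tauD_int y z : z \is a Num.int -> cos (tau * (y + z)) = cos (tau * y).
Proof.
have cosn (n : nat) (t : R) : cos (tau * (t + n%:R)) = cos (tau * t).
  by rewrite mulrDr mulr_natr periodicn//; exact: cosD2pi.
move=> /intrP[[]n ->]; first exact: cosn.
by rewrite -(cosn n.+1) NegzE mulrNz subrK.
Qed.

(** For the fractional part [r], the double angle formula gives [sin (pi * r) = 0], impossible when
    [0 < r < 1]. *)
Lemma cos_tau_eq1 x : (cos (tau * x) == 1) = (x \is a Num.int).
Proof.
apply/eqP/idP => [|xint]; last by rewrite -[x]add0r cos_tauD_int// mulr0 cos0.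
rewrite -[x](subrK (Num.floor x)%:~R) cos_tauD_int ?intr_int//; set r := x - _ => cosr.
have [r0|r0] := eqVneq r 0; first by rewrite r0 add0r intr_int.
have /andP[fx xf] := floor_itv x.
have r_gt0 : 0 < r by rewrite lt_neqAle eq_sym r0 subr_ge0.
have r_lt1 : r < 1 by rewrite ltrBlDl -[1]/(1%:~R) -intrD.
have pi0 := pi_gt0 R.
have : 0 < sin (pi * r) by apply: sin_gt0_pi; apply/andP; split; nra.
have : sin (pi * r) ^+ 2 = 0.
  rewrite sin2cos2; have : cos ((pi * r) *+ 2) = 1 by rewrite -mulrnAl.
  rewrite cos_mulr2n; lra.
by move=> /eqP; rewrite sqrf_eq0 => /eqP ->; rewrite ltxx.
Qed.

Definition circle_cos (q : circle R) : R := cos (tau * circle_repr q).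

Lemma circle_cosE x : circle_cos (circle_proj x) = cos (tau * x).
Proof.
rewrite /circle_cos -[circle_repr _](subrK x) addrC cos_tauD_int//.
by rewrite -circle_proj_eq circle_reprK.
Qed.

Lemma circle_cos_continuous : continuous circle_cos.
Proof.
apply/(@quotient_continuous _ (Quotient.quot (int_subgroup R))).
have -> : circle_cos \o \pi_(quotient_topology (Quotient.quot (int_subgroup R)))%qT
    = (fun x => cos (tau * x)).
  by apply/funext => x; rewrite -circle_cosE.
move=> x; apply: continuous_comp; last exact: continuous_cos.
by apply: cvgMr; exact: cvg_id.
Qed.

Lemma circle_cos0 : circle_cos 0 = 1.
Proof. by rewrite -circle_proj0 circle_cosE mulr0 cos0. Qed.

(** The cosine alone detects closeness to 0: on representatives in [[-1/2, 1/2]] it decreases with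
    the absolute value. *)
Lemma circle_cos_nbhs (W : set (circle R)) : nbhs (0 : circle R) W ->
  exists2 e : R, 0 < e & forall q, 1 - circle_cos q <= e -> W q.
Proof.
move=> nW; have := @circle_proj_continuous 0 W; rewrite circle_proj0 => /(_ nW).
move=> /nbhs_ballP[d /= d0 dW]; have pi0 := pi_gt0 R.
have tau_itv a : 0 <= a -> a <= 2^-1 -> tau * a \in `[0, pi].
  move=> a0 a2; rewrite in_itv /=; apply/andP; split.
    by rewrite mulr_ge0// mulrn_wge0// ltW.
  have tau2 : tau * 2^-1 = pi by rewrite mulr2n; lra.
  by rewrite -[leRHS]tau2 ler_wpM2l// mulrn_wge0// ltW.
pose d' := Num.min d (2^-1).
have d'0 : 0 < d' by rewrite lt_min d0 invr_gt0 ltr0n.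
have d'2 : d' <= 2^-1 by rewrite ge_min lexx orbT.
have d'd : d' <= d by rewrite ge_min lexx.
have d'pi : tau * d' \in `[0, pi] by apply: tau_itv => //; exact: ltW.
have cosd : cos (tau * d') < 1.
  rewrite -[ltRHS]cos0 ltr_cos//; last by rewrite in_itv /= lexx ltW.
  by rewrite mulr_gt0// mulrn_wgt0.
(* Half of the gap, so that a representative of absolute value at least [d'] violates the bound
   strictly. *)
exists ((1 - cos (tau * d')) / 2) => [|q]; first by rewrite divr_gt0// subr_gt0.
set x := circle_repr q; pose r := x - (Num.floor (x + 2^-1))%:~R.
have qr : q = circle_proj r.
  apply/eqP; rewrite -[q]circle_reprK circle_proj_eq -/x /r opprB addrCA subrr addr0.
  exact: intr_int.
have /andP[fx xf] := floor_itv (x + 2^-1).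
have r_ge : - 2^-1 <= r by rewrite /r; lra.
have r_le : r <= 2^-1 by rewrite /r; move: xf; rewrite intrD; lra.
rewrite qr circle_cosE => cosr; apply: dW; rewrite /ball /= sub0r normrN.
apply: lt_le_trans d'd; rewrite ltNge; apply/negP => d'r.
have rpi : tau * `|r| \in `[0, pi].
  have : `|r| <= 2^-1 by rewrite ler_norml r_ge.
  by have := normr_ge0 r; exact: tau_itv.
have : cos (tau * r) <= cos (tau * d').
  have -> : cos (tau * r) = cos (tau * `|r|).
    by rewrite -[in LHS]cos_norm normrM ger0_norm// mulrn_wge0// ltW.
  rewrite leNgt ltr_cos// -leNgt ler_pM2l// mulrn_wgt0//.
lra.
Qed.

Lemma angle_exists (c s : R) : c ^+ 2 + s ^+ 2 = 1 ->
  exists x, cos (tau * x) = c /\ sin (tau * x) = s.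
Proof.
move=> cs; have pi0 := pi_gt0 R.
have c1 : -1 <= c <= 1.
  have : c ^+ 2 <= 1 by have := sqr_ge0 s; lra.
  by move=> c2; apply/andP; split; nra.
have [x [xc xs]] : exists x, cos x = c /\ sin x = s.
  have sE : Num.sqrt (1 - c ^+ 2) = `|s| by rewrite -cs addrAC subrr add0r sqrtr_sqr.
  have [s0|s0] := leP 0 s.
    by exists (acos c); rewrite acosK// sin_acos// sE ger0_norm.
  by exists (- acos c); rewrite cosN sinN acosK// sin_acos// sE ltr0_norm// opprK.
exists (x / tau); rewrite mulrC divfK//.
by rewrite gt_eqF// mulrn_wgt0.
Qed.

(** Angles are chosen pointwise; the addition formulas give cosine 1 to the defect of additivity,
    which is thus an integer. *)
Lemma character_of_cos_sin (G : zmodType) (C S : G -> R) :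
    (forall x y, C (x + y) = C x * C y - S x * S y) ->
    (forall x y, S (x + y) = S x * C y + C x * S y) ->
    (forall x, C x ^+ 2 + S x ^+ 2 = 1) ->
  exists chi : {additive G -> circle R}, forall x, circle_cos (chi x) = C x.
Proof.
move=> CD SD CS.
have /choice[th thP] : forall x, exists a, cos (tau * a) = C x /\ sin (tau * a) = S x.
  by move=> x; exact: angle_exists.
pose f x := circle_proj (th x).
have fB : {morph f : x y / x - y}.
  move=> x y; rewrite /f -circle_projB; apply/eqP; rewrite circle_proj_eq -cos_tau_eq1.
  have [cx sx] := thP (x - y); have [cy sy] := thP y.
  have := CD (x - y) y; have := SD (x - y) y; rewrite subrK.
  have [<- <-] := thP x; rewrite -cx -sx -cy -sy => sE cE.
  rewrite opprB addrA -addrA mulrDr.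
  have -> : tau * th (x - y) + tau * (th y - th x) =
     (tau * th (x - y) + tau * th y) - tau * th x by rewrite -addrA -mulrBr.
  rewrite cosB cosD sinD -cE -sE.
  by rewrite -!expr2 cos2Dsin2.
pose fM := GRing.isZmodMorphism.Build G (circle R) f fB.
pose chi : {additive G -> circle R} := HB.pack f fM.
exists chi => x; rewrite -[chi x]/(circle_proj (th x)) circle_cosE.
by case: (thP x).
Qed.

End Circle.

(** * Uniformly continuous functions *)

Section DyadicUrysohn.
Variables (R : realType) (G : zmodType) (V : nat -> set G).
Hypothesis V0 : forall n, V n 0.
Hypothesis V_half : forall n x y, V n.+1 x -> V n.+1 y -> V n (x + y).

(** [dyadic n k] is the sum of the [V i.+1] over the binary digits [2 ^- i.+1]
    of [k / 2 ^ n] when [k < 2 ^ n], and everything otherwise. *)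
Fixpoint dyadic n k : set G :=
  if n is m.+1 then
    [set x | exists2 y, dyadic m k./2 y & if odd k then V n (x - y) else x = y]
  else if k is 0%N then [set 0] else setT.

(** Binary addition with carry: if the last digit is 1, [V_half] merges the two summands into one of
    the previous level. *)
Lemma dyadicS n k x v : dyadic n k x -> V n v -> dyadic n k.+1 (x + v).
Proof.
elim: n k x v => [|n IH] k x v //= [y Dy Vxy] Vv; rewrite uphalf_half.
case: ifP Vxy => /= [ok|ek] Vxy; rewrite ?add0n ?add1n.
  exists (x + v) => //; rewrite -(subrK y x) (addrC _ y) -addrA.
  by apply: IH => //; exact: V_half.
by exists x; [rewrite Vxy|rewrite addrC addKr].
Qed.

Lemma dyadicD m i k x v : dyadic (m + i) k x -> V m v ->
  dyadic (m + i) (k + 2 ^ i) (x + v).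
Proof.
elim: i k x => [|i IH] k x; first by rewrite addn0 expn0 addn1; exact: dyadicS.
rewrite addnS /= => -[y Dy Vxy] Vv; exists (y + v).
  by rewrite expnS mul2n halfD odd_double andbF add0n doubleK; exact: IH.
rewrite oddD oddX /= addbF; case: ifP Vxy => _; last by move=> ->.
by rewrite opprD addrACA subrr addr0.
Qed.

Lemma dyadic_lift n k i x : dyadic n k x -> dyadic (n + i) (k * 2 ^ i) x.
Proof.
move=> Dx; elim: i => [|i IH]; first by rewrite addn0 muln1.
by rewrite addnS /= expnS mulnCA mul2n odd_double doubleK; exists x.
Qed.

(** The extra [V n] is carried upward by [V_half], digit by digit, until it reaches [V 0]. *)
Lemma dyadic_small n k x v : dyadic n k x -> (k < 2 ^ n)%N -> V n v -> V 0 (x + v).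
Proof.
elim: n k x v => [|n IH] k x v /=; first by case: k => // -> _; rewrite add0r.
move=> [y Dy Vxy] kn Vv.
have kn' : (k./2 < 2 ^ n)%N by rewrite ltn_half_double -mul2n -expnS.
rewrite -(subrK y x) (addrC _ y) -addrA; apply: IH Dy kn' _.
by apply: V_half => //; case: ifP Vxy => // _ ->; rewrite subrr.
Qed.

Let E x : set R := [set r | exists n k, dyadic n k x /\ r = k%:R / 2 ^+ n].
Let E1 x : E x 1.
Proof. by exists 0%N, 1%N; rewrite expr0 divr1. Qed.
Let E_ge0 x : lbound (E x) 0.
Proof. by move=> _ [n [k [_ ->]]]; rewrite divr_ge0// exprn_ge0. Qed.
Let inf_le x r : E x r -> inf (E x) <= r.
Proof. by apply: ge_inf; exists 0; exact: E_ge0. Qed.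

(** The Birkhoff-Kakutani construction: [f x] is 1 minus the infimum of the dyadic numbers whose set
    contains [x]. *)
Lemma dyadic_Urysohn : exists f : G -> R,
  [/\ f 0 = 1, forall x, 0 <= f x <= 1, forall x, ~ V 0 x -> f x = 0 &
      forall n x v, V n v -> V n (- v) -> `|f (x + v) - f x| <= 2 ^- n].
Proof.
have E0 x : E x !=set0 by exists 1.
have f01 x : 0 <= inf (E x) <= 1.
  by apply/andP; split; [exact: lb_le_inf|exact: inf_le].
have step n x v : V n v -> inf (E (x + v)) <= inf (E x) + 2 ^- n.
  move=> Vv; rewrite -lerBlDr; apply: lb_le_inf => // _ [m [k [Dx ->]]].
  (* The sum of [k / 2 ^ m] and [1 / 2 ^ n] over the common denominator [2 ^ (n + m)]. *)
  rewrite lerBlDr; apply: inf_le; exists (n + m)%N, (k * 2 ^ n + 2 ^ m)%N.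
  split; first by apply: dyadicD Vv; rewrite addnC; exact: dyadic_lift.
  have p q : (2 : R) ^+ q != 0 by rewrite expf_neq0// pnatr_eq0.
  rewrite natrD natrM !natrX exprD mulrDl invfM (mulrA (k%:R * _)) mulfK//.
  by rewrite mulrCA divff// mulr1.
exists (fun x => 1 - inf (E x)); split=> [|x|x nVx|n x v Vv VNv].
- suff -> : inf (E 0) = 0 by rewrite subr0.
  apply/eqP; rewrite eq_le (andP (f01 0)).1 andbT; apply: inf_le.
  by exists 0%N, 0%N; rewrite mul0r.
- by have /andP[? ?] := f01 x; apply/andP; split; lra.
- apply/eqP; rewrite subr_eq0 eq_le (andP (f01 x)).2 andbT.
  apply: lb_le_inf => // _ [n [k [Dx ->]]].
  rewrite ler_pdivlMr ?exprn_gt0// mul1r -natrX ler_nat leqNgt; apply/negP => kn.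
  by apply: nVx; rewrite -[x]addr0; exact: dyadic_small Dx kn (V0 n).
- have := step n x v Vv; have := step n (x + v) (- v) VNv; rewrite addrK ler_norml; lra.
Qed.

End DyadicUrysohn.

Section GroupTopology.
Variables (G : zmodType) (t : Topological G).
Hypothesis gt : group_topology t.

Definition nbhs0 : set_system G := nbhs (0 : space t).

Lemma nbhs0_half U : nbhs0 U -> exists V, [/\ nbhs0 V, V 0 &
  forall x y, V x -> V y -> U (x + y)].
Proof.
move=> nU; have := gt.1 (0, 0); rewrite /continuous_at /= addr0 => /(_ U nU).
move=> [[A B] /= [nA nB] AB]; exists (A `&` B); split; first exact: filterI.
  by split; exact: (nbhs_singleton (p := (0 : space t))).
by move=> x y [Ax _] [_ By]; apply: (AB (x, y)).
Qed.

Lemma nbhs0N U : nbhs0 U -> nbhs0 [set x | U (- x)].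
Proof.
by move=> nU; have := gt.2 0; rewrite /continuous_at /= oppr0; apply.
Qed.

Lemma nbhs_translate (x : G) A : nbhs (x : space t) A <-> nbhs0 [set y | A (x + y)].
Proof.
have tr (a b : G) B : nbhs (a + b : space t) B -> nbhs (b : space t) [set y | B (a + y)].
  move=> /(gt.1 (a, b)) [[C D] /= [nC nD] CD].
  apply: filterS nD => y Dy; apply: (CD (a, y)); split => //.
  exact: (nbhs_singleton (p := (a : space t))).
split=> [nA|nA]; first by apply: tr; rewrite addr0.
have := tr (- x) x [set y | A (x + y)]; rewrite addNr => /(_ nA).
by apply: filterS => y /=; rewrite addrA subrr add0r.
Qed.

End GroupTopology.

(** * Uniform continuity, means and continuity of characters *)

Section AlmostPeriodic.
Variables (R : realType) (G : zmodType) (t : Topological G).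
Hypothesis gt : group_topology t.
Implicit Types (w c h C S : G -> R).

Definition unif_cont w := forall e : R, 0 < e ->
  nbhs0 t [set v | forall x, `|w (x + v) - w x| <= e].

Lemma unif_cont_Urysohn U : nbhs0 t U -> exists f : G -> R,
  [/\ f 0 = 1, forall x, 0 <= f x <= 1, forall x, ~ U x -> f x = 0 & unif_cont f].
Proof.
move=> nU.
have /choice[half halfP] : forall W : set G, exists V : set G, nbhs0 t W ->
    [/\ nbhs0 t V, V 0 & forall x y, V x -> V y -> W (x + y)].
  move=> W; have [nW|nW] := pselect (nbhs0 t W); last by exists setT.
  by have [V VP] := nbhs0_half gt nW; exists V.
pose V n := iter n half U.
have nV n : nbhs0 t (V n) by elim: n => //= n /halfP[].
have V0 n : V n 0 by exact: nbhs_singleton (nV n).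
have Vhalf n x y : V n.+1 x -> V n.+1 y -> V n (x + y).
  by have [_ _] := halfP _ (nV n); exact.
have [f [f0 f01 fU fV]] := dyadic_Urysohn R V0 Vhalf.
exists f; split=> // e e0.
have [n ne] : exists n, 2 ^- n <= e.
  exists (Num.truncn e^-1).+1; rewrite invf_ple ?posrE ?exprn_gt0//.
  apply: le_trans (ltW (truncnS_gt _)) _; rewrite -natrX ler_nat.
  by rewrite ltnW// ltn_expl.
apply: filterS (filterI (nV n) (nbhs0N gt (nV n))) => v [Vv VNv] x.
exact: le_trans (fV n x v Vv VNv) ne.
Qed.

Variable M : (G -> R) -> R.
Hypothesis mM : invariant_mean M.

(** Finitely many translates of the set where [w] is at least [a] cover [G], so a finite sum of
    translates of [w], all of mean [M w], is at least [a]. *)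
Lemma totally_bounded_mean_gt0 w (a : R) : totally_bounded t ->
  bounded_fct w -> (forall x, 0 <= w x) -> 0 < a ->
  nbhs0 t [set v | a <= w v] -> 0 < M w.
Proof.
move=> tb bw w0 a0 /tb[F /finite_seqP[s ->] Fs].
have bws (e : G) : bounded_fct (fun x => w (x - e)).
  exact: bounded_fct_shift (fun x => x - e) bw.
have : a <= M (fun x => \sum_(e <- s) w (x - e)).
  rewrite -[leLHS](mean_cst mM); apply: (mean_le mM) => [||x].
  - exact: bounded_fct_cst.
  - exact: bounded_fct_sum.
  have [e es [v av evx]] : [set x + y | x in [set` s] & y in [set v | a <= w v]] x.
    by rewrite Fs.
  by rewrite (big_rem e es) /= -evx (addrC e) addrK -[leLHS]addr0 lerD// sumr_ge0.
rewrite (mean_sum mM)//.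
under eq_bigr do rewrite (mean_shift mM)//.
rewrite big_const_seq count_predT iter_addr_0 => aM.
rewrite ltNge; apply/negP => M0.
by have := le_trans aM (mulrn_wle0 (size s) M0); rewrite leNgt a0.
Qed.

Lemma unif_cont_autocorr h : (forall x, `|h x| <= 1) -> unif_cont h ->
  unif_cont (autocorr M h).
Proof.
move=> h1 uh e e0; have bh : bounded_fct h by exists 1.
apply: filterS (uh e e0) => v hv x.
have b (z : G) : bounded_fct (fun y => h y * h (y + z)).
  by apply: bounded_fctM => //; exact: bounded_fct_shift (fun y => y + z) bh.
rewrite /autocorr -(meanB mM)//; apply: (mean_norm_le mM) => y.
by rewrite -mulrBr normrM -[e]mul1r ler_pM// addrA.
Qed.

Section CosSin.
Variables C S : G -> R.
Hypothesis CD : forall x y, C (x + y) = C x * C y - S x * S y.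
Hypothesis SD : forall x y, S (x + y) = S x * C y + C x * S y.
Hypothesis CS : forall x, C x ^+ 2 + S x ^+ 2 = 1.

Lemma cos_sin_bounded x : `|C x| <= 1 /\ `|S x| <= 1.
Proof.
have := CS x; have := sqr_ge0 (S x); have := sqr_ge0 (C x) => ? ? ?.
by split; rewrite ler_norml; apply/andP; split; nra.
Qed.

Lemma cos_sin_dAlembert x u : C (x + u) + C (x - u) = 2 * (C x * C u).
Proof.
have s0 : S 0 = 0.
  have := CD 0 0; have := SD 0 0; have := CS 0; rewrite addr0 => cs sE cE.
  apply/eqP/negPn/negP => s_neq0.
  (* Otherwise the sine formula at 0 gives this value, and then the cosine formula makes the square
     of [S 0] negative. *)
  have c2 : C 0 = 2^-1.
    by apply: (mulfI s_neq0); lra.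
  by have := sqr_ge0 (S 0); rewrite c2 in cE cs; lra.
have c0 : C 0 = 1.
  by have := CD 0 0; have := CS 0; rewrite addr0 s0; lra.
have := CD u (- u); have := SD u (- u); rewrite subrr s0 c0 => sE cE.
have CN : C (- u) = C u.
  transitivity (C (- u) * (C u ^+ 2 + S u ^+ 2)); first by rewrite CS mulr1.
  transitivity (C u * (C u * C (- u) - S u * S (- u)) +
    S u * (S u * C (- u) + C u * S (- u))); first lra.
  by rewrite -cE -sE mulr1 mulr0 addr0.
have SN : S (- u) = - S u.
  transitivity (S (- u) * (C u ^+ 2 + S u ^+ 2)); first by rewrite CS mulr1.
  transitivity (C u * (S u * C (- u) + C u * S (- u)) -
    S u * (C u * C (- u) - S u * S (- u))); first lra.
  by rewrite -cE -sE mulr1 mulr0 add0r.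
rewrite !CD CN SN; lra.
Qed.

(** Translating [c] by [v] or [- v] changes its mean against [C] by at most [e * s]. Adding the two
    estimates, d'Alembert's equation gives [2 * s - 2 * e * s <= 2 * C v * s], and [s] cancels. *)
Lemma character_continuous0 c : bounded_fct c -> unif_cont c ->
  0 < M (fun x => c x * C x) ->
  forall e : R, 0 < e -> nbhs0 t [set x | 1 - C x <= e].
Proof.
move=> bc uc; set s := M _ => s0 e e0.
have bC : bounded_fct C by exists 1 => x; case: (cos_sin_bounded x).
have bcC (k l : G -> G) : bounded_fct (fun x => c (k x) * C (l x)).
  by apply: bounded_fctM; exact: bounded_fct_shift.
have near v : (forall x, `|c (x - v) - c x| <= e * s) ->
    s - e * s <= M (fun x => c x * C (x + v)).
  move=> cv; rewrite -(mean_shift mM (- v)); last exact: (bcC id).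
  rewrite lerBlDr -lerBlDl -(meanB mM); [|exact: (bcC id id)|exact: (bcC (fun x => x - v))].
  apply: le_trans (ler_norm _) _; apply: (mean_norm_le mM) => x.
  rewrite subrK -mulrBl normrM distrC -[e * s]mulr1 ler_pM//.
  by case: (cos_sin_bounded x).
have es0 : 0 < e * s by rewrite mulr_gt0.
have uN := uc _ es0.
apply: filterS (filterI uN (nbhs0N gt uN)) => v [cv cNv] /=.
have h1 := near v cNv; have := near (- v) => /(_ _)/= h2.
have {h2}h2 : s - e * s <= M (fun x => c x * C (x - v)).
  by apply: h2 => x; rewrite opprK.
have : M (fun x => c x * C (x + v)) + M (fun x => c x * C (x - v)) = 2 * C v * s.
  rewrite -(meanD mM); [|exact: (bcC id)|exact: (bcC id (fun x => x - v))].
  rewrite -(meanZ mM); last exact: (bcC id id).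
  congr M; apply/funext => x; rewrite -mulrDr cos_sin_dAlembert; lra.
move=> h3; rewrite -(ler_pM2r s0); lra.
Qed.

End CosSin.

Lemma character_continuous (chi : {additive G -> circle R}) :
  (forall e : R, 0 < e -> nbhs0 t [set x | 1 - circle_cos (chi x) <= e]) ->
  dual R t chi.
Proof.
move=> chi0 x A nA; apply/(nbhs_translate gt) => /=.
have := @add_continuous (circle R) (chi x, 0) A; rewrite /= addr0 => /(_ nA).
move=> [[B D] /= [nB nD] BD].
have [e e0 eD] := circle_cos_nbhs nD.
apply: filterS (chi0 e e0) => y /eD Dy /=.
rewrite raddfD; apply: (BD (chi x, chi y)); split=> //.
exact: nbhs_singleton nB.
Qed.

End AlmostPeriodic.

(** * The Comfort-Ross theorem *)

Lemma ultra_finite_union (T : Type) (J : eqType) (F : set_system T) (s : seq J)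
    (A : J -> set T) : UltraFilter F ->
  F [set x | exists2 j, j \in s & A j x] -> exists2 j, j \in s & F (A j).
Proof.
move=> UF; elim: s => [|j s IH] FA.
  by have [x [j]] := filter_ex FA.
have [FAj|FNAj] := in_ultra_setVsetC (A j) UF.
  by exists j => //; rewrite mem_head.
have [|k ks FAk] := IH; last by exists k => //; rewrite inE ks orbT.
apply: filterS (filterI FA FNAj) => x [[k]].
by rewrite inE => /predU1P[->|ks] Akx // _; exists k.
Qed.

Section ComfortRoss.
Variables (R : realType) (G : zmodType) (t : Topological G).
Hypothesis gt : group_topology t.
Hypothesis tb : totally_bounded t.

Section UltrafilterTranslate.
Variables (F : set_system G) (f : G -> R).
Hypothesis UF : UltraFilter F.
Hypothesis f01 : forall x, 0 <= f x <= 1.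
Hypothesis uf : unif_cont t f.

Definition ultra_translate (y : G) : R := lim (f (y + x) @[x --> F]).

Let g_cvg y : f (y + x) @[x --> F] --> ultra_translate y.
Proof.
apply: (@ultra_bounded_cvg _ _ _ UF _ 1); apply: filterE => x /=.
by have /andP[? ?] := f01 (y + x); rewrite ler_norml; apply/andP; split; lra.
Qed.

Lemma ultra_translate01 y : 0 <= ultra_translate y <= 1.
Proof.
by apply/andP; split; [apply: limr_ge|apply: limr_le];
  try (by apply/cvg_ex; eexists; exact: g_cvg);
  apply: filterE => x; case/andP: (f01 (y + x)).
Qed.

Lemma ultra_translate_dist y (a e : R) : F [set x | `|f (y + x) - a| <= e] ->
  `|ultra_translate y - a| <= e.
Proof.
move=> Fa; have h : `|f (y + x) - a| @[x --> F] --> `|ultra_translate y - a|.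
  by apply: cvg_norm; apply: cvgB; [exact: g_cvg|exact: cvg_cst].
rewrite -(cvg_lim (@Rhausdorff R) h); apply: limr_le => //.
by apply/cvg_ex; eexists; exact: h.
Qed.

Lemma unif_cont_ultra_translate : unif_cont t ultra_translate.
Proof.
move=> e e0; apply: filterS (uf e0) => v fv y.
have h : `|f (y + v + x) - f (y + x)| @[x --> F] -->
    `|ultra_translate (y + v) - ultra_translate y|.
  by apply: cvg_norm; apply: cvgB; exact: g_cvg.
rewrite -(cvg_lim (@Rhausdorff R) h); apply: limr_le.
  by apply/cvg_ex; eexists; exact: h.
by apply: filterE => x; rewrite addrAC.
Qed.

(** In a totally bounded group every ultrafilter is Cauchy. *)
Lemma ultra_translate_unif (e : R) : 0 < e ->
  F [set x | forall y, `|f (y + x) - ultra_translate y| <= e].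
Proof.
move=> e0; have e20 : 0 < e / 2 by rewrite divr_gt0.
have [E /finite_seqP[s ->] Es] := tb (uf e20).
have [] := @ultra_finite_union _ _ F s
  (fun a => [set x | forall y, `|f (y + x) - f (y + a)| <= e / 2]) UF.
  apply: filterE => x.
  have [a as_ [v fv avx]] : [set a + v | a in [set` s] &
    v in [set v | forall y, `|f (y + v) - f y| <= e / 2]] x by rewrite Es.
  by exists a => // y; rewrite -avx addrA.
move=> a _ Fa; apply: filterS (Fa) => x fx y.
have : `|ultra_translate y - f (y + a)| <= e / 2.
  by apply: ultra_translate_dist; apply: filterS Fa => z; apply.
have := fx y; rewrite !ler_norml => /andP[? ?] /andP[? ?].
by apply/andP; split; lra.
Qed.

End UltrafilterTranslate.

(** The contradiction is that [s], the positive mean of [c * C], is at most [2 * e] for every [e]: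
    up to [e], [c] is a difference [w x - w (x + x0)], and [C] is almost invariant under [x0]. *)
Theorem Comfort_Ross (U : set G) : nbhs0 t U -> nbhs0 (sigma (dual R t)) U.
Proof.
move=> nU; apply: contrapT => nsU.
pose W := within (~` U) (nbhs (0 : space (sigma (dual R t)))).
have PW : ProperFilter W.
  split; last exact: within_filter.
  move=> W0; apply: nsU.
  have : nbhs (0 : space (sigma (dual R t))) [set x | ~ U x -> False] := W0.
  by apply: filterS => x nx; apply: contrapT.
have [F [UF WF]] := ultraFilterLemma PW.
have FU : F (~` U) by apply: WF; exact: withinT.
have FN A : nbhs (0 : space (sigma (dual R t))) A -> F A.
  by move=> nA; apply: WF; apply: filterS nA => x ? ?.
have [f [f0 f01 fU uf]] := unif_cont_Urysohn R gt nU.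
pose g := ultra_translate F f.
have g01 : forall y, 0 <= g y <= 1 by exact: ultra_translate01.
pose h y := f y - g y.
have h1 x : `|h x| <= 1.
  have /andP[? ?] := f01 x; have /andP[? ?] := g01 x.
  by rewrite ler_norml /h; apply/andP; split; lra.
have bh : bounded_fct h by exists 1.
have bf : bounded_fct f.
  by exists 1 => x; have /andP[? ?] := f01 x; rewrite ger0_norm.
have uh : unif_cont t h.
  move=> e e0; have e20 : 0 < e / 2 by rewrite divr_gt0.
  apply: filterS (filterI (uf _ e20) (unif_cont_ultra_translate UF f01 uf e20)).
  move=> v [fv gv] x; have := fv x; have := gv x.
  rewrite /h !ler_norml => /andP[? ?] /andP[? ?].
  by apply/andP; split; rewrite /g; lra.
(* [f] vanishes off [U], where the ultrafilter lives, so [g 0 = 0]. *)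
have h0 : h 0 = 1.
  have : `|g 0 - 0| <= 0.
    apply: ultra_translate_dist => //; apply: filterS FU => x nUx.
    by rewrite /= add0r fU// subrr normr0.
  by rewrite subr0 normr_le0 /h f0 => /eqP ->; rewrite subr0.
have [M mM] := invariant_mean_exists R G.
pose c := autocorr M h.
have bc : bounded_fct c by exact: autocorr_bounded.
have uc : unif_cont t c by exact: unif_cont_autocorr.
have sq_gt0 w : bounded_fct w -> unif_cont t w -> 0 < w 0 -> 0 < M (fun x => w x * w x).
  move=> bw uw w0; have w20 : 0 < w 0 / 2 by rewrite divr_gt0.
  apply: (totally_bounded_mean_gt0 mM (a := (w 0 / 2) * (w 0 / 2))) => //.
  - exact tb.
  - exact: bounded_fctM.
  - by move=> x; rewrite -expr2 sqr_ge0.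
  - exact: mulr_gt0.
  - apply: filterS (uw _ w20) => v /(_ 0); rewrite add0r ler_norml => /andP[? ?].
    by rewrite /= ler_pM ?(ltW w20)//; lra.
have c0 : 0 < c 0.
  rewrite /c /autocorr; under eq_fun do rewrite addr0.
  by apply: sq_gt0 => //; rewrite h0.
have c2 : 0 < M (fun x => c x ^+ 2).
  by under eq_fun do rewrite expr2; exact: sq_gt0.
have [C [S [CD SD CS s0]]] := autocorr_character mM bh c0 c2.
have [chi chiC] := character_of_cos_sin CD SD CS.
have C1 x : `|C x| <= 1 by case: (cos_sin_bounded CS x).
have bC : bounded_fct C by exists 1.
have chit : dual R t chi.
  apply: (character_continuous gt) => e e0.
  by under eq_set do rewrite chiC; exact: (character_continuous0 gt mM CD SD CS bc uc).
pose s := M (fun x => c x * C x).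
have FC (e : R) : 0 < e -> F [set x | 1 - C x <= e].
  move=> e0; apply: FN; have [_ /(_ chi chit) chis _] := sigma_coarsest (dual R t).
  pose st := space (sigma (dual R t)).
  have C_cont : (fun x : st => circle_cos (chi x)) @ (0 : st) -->
      circle_cos (chi 0).
    apply: (continuous_comp (f := chi : st -> circle R)); first exact: chis.
    exact: circle_cos_continuous.
  have /cvgrPdist_le/(_ e e0) := C_cont.
  rewrite raddf0 circle_cos0.
  by apply: filterS => x; rewrite chiC; apply: le_trans; exact: ler_norm.
suff sle (e : R) : 0 < e -> s <= e + e.
  by have := sle (s / 4); rewrite divr_gt0// => /(_ isT); rewrite /s in s0 *; lra.
move=> e0; have e20 : 0 < e / 2 by rewrite divr_gt0.
have e80 : 0 < e ^+ 2 / 8 by rewrite divr_gt0// exprn_gt0.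
(* One point [x0] whose translate of [f] is uniformly close to [g]. The bound [e ^+ 2 / 8] on
   [1 - C x0] serves to make the sine at [x0] at most [e / 2]. *)
have [x0 [[fg Cx0] Cx0']] := filter_ex (filterI (filterI
  (ultra_translate_unif UF f01 uf e0) (FC _ e20)) (FC _ e80)).
rewrite /= in Cx0 Cx0'.
have Sx0 : `|S x0| <= e / 2.
  rewrite -[leRHS]gtr0_norm// -ler_sqr ?nnegrE// !real_normK ?num_real//.
  have := CS x0; have := C1 x0; rewrite ler_norml => /andP[? ?]; nra.
pose w x := M (fun y => h y * f (y + x)).
have bhf x : bounded_fct (fun y => h y * f (y + x)).
  by apply: bounded_fctM => //; exact: bounded_fct_shift (fun y => y + x) bf.
have w1 x : `|w x| <= 1.
  apply: (mean_norm_le mM) => y; rewrite normrM -[leRHS]mul1r ler_pM//.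
  by have /andP[? ?] := f01 (y + x); rewrite ger0_norm.
have bw : bounded_fct w by exists 1.
have cw x : `|c x - (w x - w (x + x0))| <= e.
  have bhh : bounded_fct (fun y => h y * h (y + x)).
    by apply: bounded_fctM => //; exact: bounded_fct_shift (fun y => y + x) bh.
  have bd : bounded_fct (fun y => h y * f (y + x) - h y * f (y + (x + x0))).
    by apply: bounded_fctD => //; exact: bounded_fctN.
  rewrite /c /autocorr /w -(meanB mM (bhf x) (bhf _)) -(meanB mM bhh bd).
  apply: (mean_norm_le mM) => y.
  have -> : h y * h (y + x) - (h y * f (y + x) - h y * f (y + (x + x0))) =
      h y * (f (y + (x + x0)) - g (y + x)) by rewrite {2}/h; lra.
  by rewrite normrM -[e]mul1r ler_pM// addrA.
have bwC (k : G -> G) : bounded_fct (fun x => w (k x) * C x).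
  by apply: bounded_fctM => //; exact: bounded_fct_shift.
have step1 : s <= M (fun x => w x * C x - w (x + x0) * C x) + e.
  have bd : bounded_fct (fun x => w x * C x - w (x + x0) * C x).
    by apply: bounded_fctD; [exact: (bwC id)|apply: bounded_fctN; exact: bwC].
  rewrite -lerBlDl /s -(meanB mM)//; last exact: bounded_fctM.
  apply: le_trans (ler_norm _) _; apply: (mean_norm_le mM) => x.
  rewrite -mulrBl -mulrBl normrM -[e]mulr1 ler_pM//.
have step2 : M (fun x => w x * C x - w (x + x0) * C x) <= e.
  rewrite (meanB mM); [|exact: (bwC id)|exact: bwC].
  (* Shifting the first mean by [x0] moves the difference from [w] onto [C]. *)
  rewrite -(mean_shift mM x0); last exact: (bwC id).
  have bwC' : bounded_fct (fun x => w (x + x0) * C (x + x0)).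
    exact: bounded_fct_shift (fun x => x + x0) (bwC id).
  rewrite -(meanB mM)//; apply: le_trans (ler_norm _) _.
  apply: (mean_norm_le mM) => x; rewrite -mulrBr normrM -[e]mul1r ler_pM//.
  have -> : C (x + x0) - C x = - (C x * (1 - C x0) + S x * S x0) by rewrite CD; lra.
  have [Cx Sx] := cos_sin_bounded CS x.
  rewrite normrN; apply: le_trans (ler_normD _ _) _; rewrite !normrM [leRHS]splitr.
  have C0' : `|1 - C x0| <= e / 2.
    by rewrite ger0_norm// subr_ge0; exact: le_trans (ler_norm _) (C1 x0).
  by rewrite -[e / 2]mul1r lerD// ler_pM.
by apply: le_trans step1 _; rewrite lerD2r.
Qed.

End ComfortRoss.

(** * Characters and ideal convergence *)

Section Comparison.
Variables (G : zmodType).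
Implicit Types (t : Topological G) (P : set (Topological G)).

Lemma nbhs_opens t t' (x : G) A : opens t `<=` opens t' ->
  nbhs (x : space t) A -> nbhs (x : space t') A.
Proof.
by move=> tt'; rewrite !nbhsE => -[B [oB Bx] BA]; exists B => //; split => //; exact: tt'.
Qed.

Lemma nbhs_opens_sub t t' :
  (forall (x : G) A, nbhs (x : space t) A -> nbhs (x : space t') A) ->
  opens t `<=` opens t'.
Proof.
by move=> tt' A; rewrite /opens !openE => oA x /oA; exact: tt'.
Qed.

Lemma nbhs0_opens_sub t t' : group_topology t -> group_topology t' ->
  (forall U, nbhs0 t U -> nbhs0 t' U) -> opens t `<=` opens t'.
Proof.
move=> gt gt' tt'; apply: nbhs_opens_sub => x A.
by move=> /(nbhs_translate gt)/tt' nA; apply/(nbhs_translate gt').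
Qed.

Lemma sup_of_cvg P (F : set_system G) (x : G) : Filter F ->
  (forall t, P t -> F --> (x : space t)) -> F --> (x : space (sup_of P)).
Proof.
move=> FF FP; apply/(cvg_sup (fun t : {t | P t} => sval t) x FF).
by move=> [t Pt]; exact: FP.
Qed.

Lemma sup_of_ub P t : P t -> opens t `<=` opens (sup_of P).
Proof.
move=> Pt; apply: nbhs_opens_sub => x.
have [+ _] := cvg_sup (fun t : {t | P t} => sval t) x
  (nbhs_filter (x : space (sup_of P))).
by move=> /(_ (@cvg_id _ _)) /(_ (exist _ t Pt)).
Qed.

Lemma sup_of_lub P t : (forall t', P t' -> opens t' `<=` opens t) ->
  opens (sup_of P) `<=` opens t.
Proof.
move=> Pt; apply: nbhs_opens_sub => x.
apply: (sup_of_cvg (nbhs_filter (x : space t))) => t' Pt' A.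
exact: nbhs_opens (Pt _ Pt').
Qed.

Lemma hausdorff_opens t t' : opens t `<=` opens t' ->
  hausdorff_space (space t) -> hausdorff_space (space t').
Proof.
move=> tt' ht x y xy; apply: ht => A B nA nB.
by apply: xy; exact: nbhs_opens tt' _.
Qed.

End Comparison.

(** * Topologies generated by characters *)

Section Characters.
Variables (R : realType) (G : zmodType).
Implicit Types (t : Topological G) (H : set {additive G -> circle R}).

Lemma dual_opens t t' : opens t `<=` opens t' -> dual R t `<=` dual R t'.
Proof. by move=> tt' chi chit x A /chit; exact: nbhs_opens tt'. Qed.

Lemma sigma_mono H H' : H `<=` H' -> opens (sigma H) `<=` opens (sigma H').
Proof.
move=> HH'; have [gH' cH' _] := sigma_coarsest H'.
have [_ _] := sigma_coarsest H; apply => // chi /HH'; exact: cH'.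
Qed.

Lemma sigma_cvg0 H (F : set_system G) : Filter F ->
  (forall chi, H chi -> chi x @[x --> F] --> (0 : circle R)) ->
  F --> ((0 : G) : space (sigma H)).
Proof.
move=> FF FH; apply/(cvg_sup (fun chi : {chi | H chi} =>
  Topological.class (initial_topology (sval chi : G -> circle R)))) => -[chi Hchi] A /=.
rewrite (@nbhsE (initial_topology (chi : G -> circle R))).
move=> [_ [[B oB <-] B0] BA]; apply: filterS BA _.
apply: (FH chi Hchi); apply: open_nbhs_nbhs; split => //.
by rewrite -(raddf0 chi).
Qed.

(** The color of a point is its arc among [N] arcs of length [1 / N], with [1 / N] below the radius
    [d]. *)
Lemma circle_coloring (W : set (circle R)) : nbhs (0 : circle R) W ->
  exists (J : finType) (c : circle R -> J), forall p q, c p = c q -> W (q - p).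
Proof.
move=> nW; have := @circle_proj_continuous R 0 W; rewrite circle_proj0 => /(_ nW).
move=> /nbhs_ballP[d /= d0 dW].
pose N := (Num.truncn d^-1).+1.
have N0 : 0 < N%:R :> R by rewrite ltr0n.
have Nd : N%:R^-1 < d by rewrite invf_plt ?posrE// truncnS_gt.
pose frac (q : circle R) : R := circle_repr q - (Num.floor (circle_repr q))%:~R.
have frac01 q : 0 <= frac q < 1.
  have /andP[? ?] := floor_itv (circle_repr q); rewrite subr_ge0.
  by apply/andP; split => //; rewrite ltrBlDl -[1]/(1%:~R) -intrD.
have fracK q : circle_proj (frac q) = q.
  rewrite -[RHS]circle_reprK; apply/eqP; rewrite circle_proj_eq /frac addrAC subrr add0r.
  by rewrite rpredN intr_int.
pose c q := Num.truncn (N%:R * frac q).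
have cN q : (c q < N)%N.
  have /andP[q0 q1] := frac01 q.
  rewrite /c truncn_lt_nat ?mulr_ge0//.
  by rewrite -[ltRHS]mulr1 ltr_pM2l.
exists 'I_N, (fun q => Ordinal (cN q)) => p q [] pq.
rewrite -(fracK p) -(fracK q) -circle_projB; apply: dW.
have /andP[p_ge0 _] := frac01 p; have /andP[q_ge0 _] := frac01 q.
have /andP[p1 p2] : (c p)%:R <= N%:R * frac p < (c p).+1%:R.
  by apply: truncn_itv; rewrite mulr_ge0.
have /andP[q1 q2] : (c q)%:R <= N%:R * frac q < (c q).+1%:R.
  by apply: truncn_itv; rewrite mulr_ge0.
rewrite /ball /= sub0r normrN; apply: lt_trans Nd.
rewrite -(ltr_pM2l N0) mulfV ?gt_eqF// -[X in X * _]ger0_norm ?(ltW N0)// -normrM.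
rewrite -[c p]/(c p) pq in p1 p2.
rewrite ltr_norml mulrBr; move: p1 p2 q1 q2; rewrite -natr1 => ? ? ? ?.
by apply/andP; split; lra.
Qed.

(** Sets containing all differences within the color classes of some finite coloring form a filter,
    by taking product colorings. This filter converges to 0, and one representative per color gives
    the finite set. *)
Lemma sigma_totally_bounded H : totally_bounded (sigma H).
Proof.
pose F : set_system G := [set U | exists (J : finType) (c : G -> J),
  forall x y, c x = c y -> U (y - x)].
have FF : Filter F.
  split.
  - by exists unit, (fun=> tt).
  - move=> U V [J [c cU]] [J' [c' cV]]; exists (J * J')%type, (fun x => (c x, c' x)).
    by move=> x y [cxy c'xy]; split; [exact: cU|exact: cV].
  - by move=> U V UV [J [c cU]]; exists J, c => x y /cU /UV.
have F0 : F --> ((0 : G) : space (sigma H)).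
  apply: sigma_cvg0 => chi Hchi W nW; have [J [c cW]] := circle_coloring nW.
  by exists J, (c \o chi) => x y /cW; rewrite /= raddfB.
(* A color that is not attained gets the default representative 0. *)
move=> U /F0[J [c cU]]; pose r j := xget 0 [set x | c x = j].
exists (r @` setT); first exact/finite_image/finite_finset.
apply/seteqP; split=> // x _; exists (r (c x)); first by exists (c x).
exists (x - r (c x)); last by rewrite addrC subrK.
by apply: cU; rewrite /r; case: xgetP => [y _ /=|/(_ x)/(_ erefl)].
Qed.

End Characters.

(** * Ideal convergence and the finest topologies *)

Section IdealConvergence.
Variables (R : realType) (G : zmodType) (I : set (set nat)) (u : nat -> G).
Hypothesis idI : is_ideal I.
Implicit Types (t : Topological G).

(** The image under [u] of the filter dual to [I]; convergence along it is ideal convergence of [u].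
    It is improper when [I] contains every set. *)
Definition ideal_filter : set_system G := [set A | I [set n | ~ A (u n)]].

#[local] Instance ideal_filter_filter : Filter ideal_filter.
Proof.
have [[X IX] Isub IU] := idI; split.
- by apply: Isub IX => n nT; exfalso; apply: nT.
- move=> A B IA IB; apply: Isub (IU _ _ IA IB) => n /= nAB.
  by have [Aun|] := pselect (A (u n)); [right=> ?; exact: nAB|left].
- by move=> A B AB; apply: Isub => n nB /AB.
Qed.

Lemma cvg0_sup_of (P : set (Topological G)) :
  (forall t, P t -> cvg0_in I u t) -> cvg0_in I u (sup_of P).
Proof.
move=> Pt; apply: (@sup_of_cvg _ P ideal_filter 0) => t /Pt; exact.
Qed.

Lemma cvg0_sigma : cvg0_in I u (sigma (s_u R I u)).
Proof. by apply: (@sigma_cvg0 _ _ _ ideal_filter) => chi; exact. Qed.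

Lemma dual_sub_s_u t : cvg0_in I u t -> dual R t `<=` s_u R I u.
Proof.
move=> ut chi chit W nW; apply: (ut (chi @^-1` W)).
by apply: chit; rewrite raddf0.
Qed.

Hypothesis TBu : TB_sequence I u.

Lemma opens_sub_sigma_s_u t : group_topology t -> totally_bounded t ->
  cvg0_in I u t -> opens t `<=` opens (sigma (s_u R I u)).
Proof.
move=> gt tb ut; have [gd _ _] := sigma_coarsest (dual R t).
apply: subset_trans (sigma_mono (dual_sub_s_u ut)).
by apply: nbhs0_opens_sub => // U; exact: Comfort_Ross.
Qed.

Lemma precompact_sigma_s_u : precompact_group_topology (sigma (s_u R I u)).
Proof.
have [t [[[gt ht] tb] ut]] := TBu; have [gs _ _] := sigma_coarsest (s_u R I u).
split; last exact: sigma_totally_bounded.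
by split=> //; apply: hausdorff_opens ht; exact: opens_sub_sigma_s_u.
Qed.

(** Serves for both suprema, as [sigma (s_u R I u)] belongs to both families: its characters remain
    continuous in the finer supremum, where [u] still converges to 0. *)
Lemma dual_sup_of (P : set (Topological G)) :
  (forall t, P t -> cvg0_in I u t) -> P (sigma (s_u R I u)) ->
  dual R (sup_of P) = s_u R I u.
Proof.
move=> Pu Ps; apply/seteqP; split; first exact/dual_sub_s_u/cvg0_sup_of.
have [_ cs _] := sigma_coarsest (s_u R I u).
by move=> chi /cs; apply: dual_opens; exact: sup_of_ub.
Qed.

End IdealConvergence.

Theorem corollary6p4 (R : realType) (G : zmodType)
    (I : set (set nat)) (u : nat -> G) :
  is_ideal I -> free_ideal I -> TB_sequence I u ->
  [/\ opens (T_pu I u) = opens (plus_topology R (T_u I u)),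
      opens (plus_topology R (T_u I u)) = opens (sigma (s_u R I u)),
      s_u R I u = dual R (T_u I u) &
      dual R (T_u I u) = dual R (T_pu I u)].
Proof.
move=> idI _ TBu.
have ps := precompact_sigma_s_u R TBu.
have us : cvg0_in I u (sigma (s_u R I u)) by exact: cvg0_sigma.
have dT : dual R (T_u I u) = s_u R I u.
  by apply: dual_sup_of => // [t []|] //; split=> //; case: ps.
have dTp : dual R (T_pu I u) = s_u R I u.
  by apply: dual_sup_of => // t [].
(* Once the duals are known, the plus topology is [sigma (s_u R I u)], and only its equality with
   [T_pu I u] remains. *)
rewrite /plus_topology dT dTp; split=> //; apply/seteqP; split.
  by apply: sup_of_lub => t [[[gt _] tb] ut]; exact: opens_sub_sigma_s_u.
exact: sup_of_ub.
Qed.
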